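(* Consider the $\infty$-SOS model with parameter $\theta>0$, spin values $\{0,1,2\}$ (i.e. $m=2$), on the Cayley tree of order $k=3$. Let $$\theta_c=\frac{(1-c^2)\sqrt{c(1+c-c^2)}}{c^4-3c^2+2c-2\sqrt2-1},\qquad c=\sqrt[3]{1+\sqrt2},$$ so that $\theta_c\approx 0.206$. Then there exists a critical value $\widehat\theta_c\approx 0.4812$ such that the following hold. 1. If $\theta>\widehat\theta_c$, then there is a unique translation-invariant splitting Gibbs measure. 2. If $\theta=\widehat\theta_c$, then there are exactly three translation-invariant splitting Gibbs measures. 3. If $\theta\in(\theta_c,\widehat\theta_c)$, then there are exactly five translation-invariant splitting Gibbs measures. 4. If $\theta=\theta_c$, then there are exactly six translation-invariant splitting Gibbs measures. 5. If $\theta\in(0,\theta_c)$, then there are exactly seven translation-invariant splitting Gibbs measures.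
   Context: Cayley tree of order $k$: the infinite tree $\Gamma^k=(V,L)$ in which each vertex has exactly $k+1$ neighbors, with a fixed root $x^0\in V$ and graph distance $d$. Write $V_n=\{x\in V: d(x,x^0)\le n\}$ and $W_n=\{x\in V: d(x,x^0)=n\}$. $\infty$-SOS model with $m=2$: spins take values in $\{0,1,2\}$. A configuration $\sigma$ on $A\subseteq V$ is admissible if $|\sigma(x)-\sigma(y)|\in\{0,1\}$ for every edge $\langle x,y\rangle$ with both endpoints in $A$. Let $\Omega$ be the set of admissible configurations on $V$ and $\Omega_A$ the set of admissible configurations on $A$. The activities are $\lambda_{i,i}=1$ and $\lambda_{i,j}=\theta$ if $|i-j|=1$, where $\theta>0$ (pairs with $|i-j|\ge2$ are forbidden). Splitting Gibbs measure (SGM): given positive vectors $z_x=(z_{0,x},z_{1,x},z_{2,x})$, $x\in V\setminus\{x^0\}$, normalized by $z_{2,x}=1$, define for $n\ge1$ the probability measure on $\Omega_{V_n}$ $$\mu^{(n)}(\sigma_n)=\frac1{Z_n}\prod_{\langle x,y\rangle\subset V_n}\lambda_{\sigma_n(x),\sigma_n(y)}\prod_{x\in W_n}z_{\sigma_n(x),x},$$ where $Z_n$ is the normalizing constant. The sequence $(\mu^{(n)})_{n\ge1}$ is compatible if for all $n\ge2$ the marginal of $\mu^{(n)}$ on $V_{n-1}$ equals $\mu^{(n-1)}$. In that case the unique probability measure $\mu$ on $\Omega$ whose marginal on each $V_n$ is $\mu^{(n)}$ is called the SGM corresponding to $z$. A translation-invariant SGM is an SGM corresponding to a function $z$ that is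 constant, $z_x\equiv z=(z_0,z_1,1)$. Compatibility for constant $z$ amounts to the system $$z_0=\Big(\frac{z_0+\theta z_1}{\theta z_1+1}\Big)^k,\qquad z_1=\Big(\frac{\theta z_0+z_1+\theta}{\theta z_1+1}\Big)^k,\qquad z_0,z_1>0,$$ and the translation-invariant SGMs are counted by the positive solutions $(z_0,z_1)$ of this system. *)

(* Defs.v *)
From HB Require Import structures.
From mathcomp Require Import all_boot all_order all_algebra finmap.
From mathcomp Require Import zify.
From mathcomp Require Import all_classical all_reals all_analysis.

Set Implicit Arguments.
Unset Strict Implicit.
Unset Printing Implicit Defensive.

Import Order.TTheory GRing.Theory Num.Theory.

Local Open Scope classical_set_scope.
Local Open Scope ring_scope.

(* The Cayley tree of order k is realized as the Cayley graph of the free     *)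
(* product of k+1 copies of Z/2Z: vertices are the words over k+1 letters     *)
(* without two equal consecutive letters, the root is the empty word, and     *)
(* edges join w to a :: w. The lemmas below check that this is a              *)
(* (k+1)-regular tree in which word length is the distance to the root.       *)

Definition reduced (k : nat) (w : seq 'I_k.+1) : bool :=
  sorted (fun a b => a != b) w.

Record vertex (k : nat) := Vertex {
  word :> seq 'I_k.+1;
  word_reduced : reduced word }.

HB.instance Definition _ k := [isSub for @word k].
HB.instance Definition _ k := [Countable of vertex k by <:].

Definition tree_root {k : nat} : vertex k := @Vertex k [::] isT.

(* [depth x] is the distance d(x, x^0). *)
Definition depth {k : nat} (x : vertex k) : nat := size x.

Definition child {k : nat} (x y : vertex k) : bool :=
  [exists a : 'I_k.+1, word y == a :: word x].

Definition adj {k : nat} (x y : vertex k) : bool := child x y || child y x.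

Lemma childP k (x y : vertex k) :
  reflect (exists a : 'I_k.+1, word y = a :: word x) (child x y).
Proof. by apply: (iffP existsP) => -[a /eqP]; exists a => //; apply/eqP. Qed.

Lemma child_depth k (x y : vertex k) : child x y -> depth y = (depth x).+1.
Proof. by case/childP=> a E; rewrite /depth E. Qed.

Lemma adj_sym k : symmetric (@adj k).
Proof. by move=> x y; rewrite /adj orbC. Qed.

Lemma adj_irr k : irreflexive (@adj k).
Proof.
by move=> x; rewrite /adj orbb; case E: child => //; move: (child_depth E); lia.
Qed.

Lemma parent_uniq k (x y z : vertex k) : child x z -> child y z -> x = y.
Proof.
move=> /childP[a Ea] /childP[b]; rewrite Ea => -[_ E].
by apply: val_inj.
Qed.

Lemma reduced_cons k (x : vertex k) (a : 'I_k.+1) :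
  reduced (a :: word x) = (ohead (word x) != Some a).
Proof.
case: x => -[|b w] //= hw; rewrite /reduced /=.
rewrite /reduced /= in hw; rewrite hw andbT; congr (~~ _).
by apply/eqP/eqP => [->|[]].
Qed.

Lemma child_exists k (x : vertex k) (a : 'I_k.+1) :
  ohead (word x) != Some a -> {y : vertex k | word y = a :: word x}.
Proof. by rewrite -reduced_cons => h; exists (Vertex h). Qed.

Lemma parent_exists k (x : vertex k) : x != tree_root -> exists y, child y x.
Proof.
case: x => -[|a w] hw nr; first by case/eqP: nr; apply: val_inj.
have hw' : reduced w by move: (hw); rewrite /reduced /=; exact: path_sorted.
by exists (Vertex hw'); apply/childP; exists a.
Qed.

Lemma adj_degree k (x : vertex k) :
  exists s : seq (vertex k),
    [/\ uniq s, size s = k.+1 & forall y, (y \in s) = adj x y].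
Proof.
pose ch := pmap insub [seq a :: word x | a <- enum 'I_k.+1] : seq (vertex k).
have uch : uniq ch.
  rewrite /ch (pmap_uniq (insubK _)) // map_inj_uniq ?enum_uniq //.
  by move=> a b [].
have mch y : (y \in ch) = child x y.
  rewrite mem_pmap_sub; apply/mapP/childP => [[a _ E]|[a E]]; exists a => //.
  by rewrite mem_enum.
have sch : size ch = count (fun a => ohead (word x) != Some a) (enum 'I_k.+1).
  rewrite size_pmap_sub count_map; apply: eq_count => a /=.
  by rewrite -reduced_cons.
have [xr|nr] := eqVneq x tree_root.
  exists ch; split => //.
    by rewrite sch xr /= (eq_count (a2 := predT)) // count_predT size_enum_ord.
  move=> y; rewrite mch /adj; have [//|_ /=] := boolP (child x y).
  by case E: child => //; move: (child_depth E); rewrite xr.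
have [y yx] := parent_exists nr.
have [b Eb] := childP _ _ yx.
exists (y :: ch); split => /=.
- rewrite uch andbT mch; apply/negP => xy.
  by move: (child_depth yx) (child_depth xy); lia.
- have := count_predC (pred1 b) (enum 'I_k.+1).
  rewrite count_uniq_mem ?enum_uniq // mem_enum size_enum_ord /= sch Eb /=.
  rewrite add1n => -[E]; congr _.+1; rewrite -[RHS]E; apply: eq_count => a /=.
  by rewrite eq_sym; congr (~~ _); apply/eqP/eqP => [[]|->].
- move=> u; rewrite inE mch /adj orbC; congr (_ || _).
  by apply/eqP/idP => [->//|ux]; exact: parent_uniq ux yx.
Qed.

Lemma adj_depth k (x y : vertex k) : adj x y -> (depth y <= (depth x).+1)%N.
Proof. by case/orP => h; have := child_depth h; lia. Qed.

Lemma depth_dist k (x : vertex k) :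
  (exists p, [/\ path adj tree_root p, last tree_root p = x & size p = depth x]) /\
  (forall p, path adj tree_root p -> last tree_root p = x -> (depth x <= size p)%N).
Proof.
split; last first.
  move=> p hp <-; rewrite -[size p]addn0 -[0%N]/(depth (@tree_root k)).
  elim: p tree_root hp => [|z p IH] r //= /andP[rz hp].
  apply: (leq_trans (IH _ hp)); rewrite addSn -addnS leq_add2l.
  exact: adj_depth.
move: {2}(depth x) (erefl (depth x)) => n; elim: n x => [|n IH] x dx.
  by exists [::]; rewrite dx; split => //=; apply: val_inj => /=;
     move/size0nil: dx => ->.
have [y yx] : exists y, child y x.
  by apply: parent_exists; apply/eqP => E; move: dx; rewrite E.
have dy : depth y = n by move: (child_depth yx); rewrite dx => -[].
have [p [hp lp sp]] := IH y dy.
exists (rcons p x); rewrite rcons_path last_rcons size_rcons hp lp sp dy dx.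
by rewrite /adj yx.
Qed.

Lemma adj_acyclic k (c : seq (vertex k)) : (2 < size c)%N -> ~~ ucycleb adj c.
Proof.
move=> sc; apply/negP => /andP[cc uc].
have [x xc xmax] : exists2 x, x \in c & forall y, y \in c -> (depth y <= depth x)%N.
  case: c sc {cc uc} => // x0 c _.
  case: (@arg_maxnP (seq_sub (x0 :: c)) (SeqSub (mem_head x0 c)) xpredT
         (fun u => depth (val u))) => // u _ hu.
  exists (val u); first exact: valP.
  by move=> y yc; exact: (hu (SeqSub yc) isT).
have up y : y \in c -> adj x y -> child y x.
  move=> yc /orP[/child_depth E|//].
  by move: (xmax _ yc); rewrite E ltnn.
have [i s Es] := rot_to xc.
have ur : uniq (x :: s) by rewrite -Es rot_uniq.
have cr : cycle adj (x :: s) by rewrite -Es rot_cycle.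
have mr y : y \in s -> y \in c by rewrite -(mem_rot i c) Es inE orbC => ->.
have : (2 < size (x :: s))%N by rewrite -Es size_rot.
case: s {Es} ur cr mr => [|y s] //; case/lastP: s => [|s z] // ur cr mr _.
move: cr; rewrite /= rcons_path last_rcons => /andP[xy /andP[_ zx]].
have E : y = z.
  apply: (@parent_uniq _ y z x); apply: up => //; first 1 last.
  - by apply: mr; rewrite inE mem_rcons mem_head orbT.
  - by rewrite adj_sym.
  - by apply: mr; exact: mem_head.
by move: ur; rewrite E /= mem_rcons mem_head /= andbF.
Qed.

Lemma finite_depth k (n : nat) : finite_set [set x : vertex k | (depth x <= n)%N].
Proof.
pose L := [seq tval t | m <- iota 0 n.+1, t <- enum {: m.-tuple 'I_k.+1}].
apply: (@sub_finite_set _ _ [set` pmap insub L : seq (vertex k)]); last first.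
  exact: finite_seq.
move=> x /= hx; rewrite mem_pmap_sub; apply/allpairsPdep.
exists (size x), (in_tuple x); split => //; last by rewrite mem_enum.
by rewrite mem_iota add0n ltnS.
Qed.

(* The ball V_n; the sphere W_n consists of the x with [depth x = n].         *)
Definition ball_V (k n : nat) : {fset vertex k} :=
  fset_set [set x : vertex k | (depth x <= n)%N].

Lemma in_ball_V k n (x : vertex k) : (x \in ball_V k n) = (depth x <= n)%N.
Proof.
by rewrite in_fset_set ?mem_setE //; exact: finite_depth.
Qed.

Definition spin := 'I_3.

Definition allowed (i j : spin) : bool := (`|i - j|%N <= 1)%N.

Definition activity (R : realType) (theta : R) (i j : spin) : R :=
  if i == j then 1 else if allowed i j then theta else 0.

(* Omega_A for a finite set A of vertices *)
Definition finite_config (k : nat) (A : {fset vertex k})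
    : {set {ffun A -> spin}} :=
  [set s : {ffun A -> spin} |
    [forall x : A, [forall y : A, adj (val x) (val y) ==> allowed (s x) (s y)]]].

Definition extends (k : nat) (A B : {fset vertex k})
    (s : {ffun B -> spin}) (t : {ffun A -> spin}) : bool :=
  [forall x : A, [forall y : B, (val x == val y) ==> (s y == t x)]].

(* Omega *)
Record config (k : nat) := Config {
  spins :> vertex k -> spin;
  config_allowed : forall x y, adj x y -> allowed (spins x) (spins y) }.

Definition config0 (k : nat) : config k :=
  @Config k (fun=> ord0) (fun _ _ _ => isT).

HB.instance Definition _ k := gen_eqMixin (config k).
HB.instance Definition _ k := gen_choiceMixin (config k).
HB.instance Definition _ k := isPointed.Build (config k) (config0 k).

Definition coordinate_sets (k : nat) : set (set (config k)) :=
  [set A | exists (x : vertex k) (i : spin), A = [set s : config k | s x = i]].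

(* Omega with its product sigma-algebra *)
Notation configs k := (g_sigma_algebraType (@coordinate_sets k)).

Definition cylinder (k : nat) (A : {fset vertex k}) (t : {ffun A -> spin})
    : set (configs k) :=
  [set s : config k | forall x : A, s (val x) = t x].

(* z_{i,x} = z x i; the value of z at the root is never used. Every edge      *)
(* <x,y> is enumerated once, oriented away from the root.                     *)
Definition weight (R : realType) (k : nat) (theta : R)
    (z : vertex k -> spin -> R) (n : nat) (s : {ffun ball_V k n -> spin}) : R :=
  (\prod_(x : ball_V k n) \prod_(y : ball_V k n | child (val x) (val y))
     activity theta (s x) (s y)) *
  \prod_(x : ball_V k n | depth (val x) == n) z (val x) (s x).

Definition partition_function (R : realType) (k : nat) (theta : R)
    (z : vertex k -> spin -> R) (n : nat) : R :=
  \sum_(s in finite_config (ball_V k n)) weight theta z s.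

Definition finite_gibbs (R : realType) (k : nat) (theta : R)
    (z : vertex k -> spin -> R) (n : nat) (s : {ffun ball_V k n -> spin}) : R :=
  weight theta z s / partition_function theta z n.

Definition compatible (R : realType) (k : nat) (theta : R)
    (z : vertex k -> spin -> R) : Prop :=
  forall n, (2 <= n)%N ->
  forall t, t \in finite_config (ball_V k n.-1) ->
    \sum_(s in finite_config (ball_V k n) | extends s t) finite_gibbs theta z s
    = finite_gibbs theta z t.

Definition is_SGM (R : realType) (k : nat) (theta : R)
    (z : vertex k -> spin -> R) (mu : probability (configs k) R) : Prop :=
  [/\ forall x, x != tree_root -> (forall i, 0 < z x i) /\ z x ord_max = 1,
      compatible theta z
    & forall n, (1 <= n)%N ->
      forall t, t \in finite_config (ball_V k n) ->
        mu (cylinder t) = (finite_gibbs theta z t)%:E].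

Definition is_TISGM (R : realType) (k : nat) (theta : R)
    (mu : probability (configs k) R) : Prop :=
  exists z : vertex k -> spin -> R,
    is_SGM theta z mu /\ exists z0, forall x, x != tree_root -> z x = z0.

(* A measure of the library is a function on all subsets, unconstrained       *)
(* outside the sigma-algebra; hence the comparison on measurable sets only.   *)
Definition same_measure (R : realType) (k : nat)
    (mu nu : probability (configs k) R) : Prop :=
  forall A : set (configs k), measurable A -> mu A = nu A.

Definition exactly_TISGM (R : realType) (k : nat) (theta : R) (N : nat) : Prop :=
  exists mu : 'I_N -> probability (configs k) R,
    [/\ forall i, is_TISGM theta (mu i),
        forall i j, same_measure (mu i) (mu j) -> i = j
      & forall nu : probability (configs k) R, is_TISGM theta nu ->
          exists i, same_measure nu (mu i)].

Definition cbrt_silver (R : realType) : R := (1 + Num.sqrt 2) `^ (3^-1).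

Definition theta_c (R : realType) : R :=
  let c := cbrt_silver R in
  (1 - c ^+ 2) * Num.sqrt (c * (1 + c - c ^+ 2)) /
  (c ^+ 4 - 3 * c ^+ 2 + 2 * c - 2 * Num.sqrt 2 - 1).

(* Main.v *)
From HB Require Import structures.
Require Import Defs.
From mathcomp Require Import all_boot all_order all_algebra finmap.
From mathcomp Require Import zify ring lra.
From mathcomp Require Import all_classical all_reals all_analysis.

(* Summing out the outermost sphere multiplies the weight of a configuration by
   the factors (sum_j lambda_ij z_j)^k at its boundary spins i, so compatibility
   for constant z says that (sum_j lambda_ij z_j)^k / z_i does not depend on i
   (necessity is seen on constant configurations). A compatible family extends
   to a measure by realizing its marginals as the lengths of nested partitions
   of [0, 1) and pushing the uniform law forward; cylinders form a pi-system,
   and constant configurations on V_1 recover z, so the translation-invariant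
   measures are in bijection with the positive solutions of the system.

   Put u^3 = z_0 and v^3 = z_1. Either u = 1, and v is on a level set of
   v |-> (v^3 - v) / (v^4 - 2), whose maximum on (0, 1) is theta_c; or, with
   w = sqrt u, p = v / w, P = p^2 and T = theta^2, one has theta p^3 = w + 1/w
   and T^2 P^4 - T P^3 + (1 - 3T) P + 1 = 0. Real w <> 1 corresponds to
   T P^3 > 4, that is P >= 3, and every such P gives the two solutions w and
   1/w. The quartic divided by P^2 is convex in P, hence there are at most two
   such P; they merge at the parameter theta_hat^2 where the quartic has a
   double root, and theta_hat > theta_c. *)

Set Implicit Arguments.
Unset Strict Implicit.
Unset Printing Implicit Defensive.

Import Order.TTheory GRing.Theory Num.Theory.

Local Open Scope ring_scope.

(** * Nested partitions of the unit interval *)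

Section Nested.
Local Open Scope classical_set_scope.
Variable R : realType.

(* Position of the interval of length p t when an interval is split into
   consecutive intervals of lengths p, in the order of the enumeration of T. *)
Definition offset (T : finType) (P : pred T) (p : T -> R) (t : T) : R :=
  \sum_(s | P s && (enum_rank s < enum_rank t)%N) p s.

Lemma offset_ge0 (T : finType) (P : pred T) (p : T -> R) t :
  (forall s, 0 <= p s) -> 0 <= offset P p t.
Proof. by move=> p0; apply: sumr_ge0. Qed.

Lemma offset_le (T : finType) (P : pred T) (p : T -> R) t : P t ->
  (forall s, 0 <= p s) -> offset P p t + p t <= \sum_(s | P s) p s.
Proof.
move=> Pt p0.
rewrite [leRHS](bigID (fun s => (enum_rank s < enum_rank t)%N)) /= lerD2l.
rewrite (bigD1 t) /= ?ltnn ?Pt // lerDl; exact: sumr_ge0.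
Qed.

Lemma offset_lt (T : finType) (P : pred T) (p : T -> R) s t : P s ->
  (forall s, 0 <= p s) -> (enum_rank s < enum_rank t)%N ->
  offset P p s + p s <= offset P p t.
Proof.
move=> Ps p0 st.
rewrite /offset [leRHS](bigD1 s) /= ?Ps ?st // [leLHS]addrC lerD2l.
rewrite [leRHS]big_mkcond [leLHS]big_mkcond /=; apply: ler_sum => u _.
case: (P u) => //=; case: ltnP => us /=; last by case: ifP.
by rewrite (ltn_trans us st) /=; case: eqP us => // ->; rewrite ltnn.
Qed.

(** The required [t] is the first one whose right end exceeds [x]. One exists because the right end
    of the last element of [P] is the total sum, and its left end is at most [x] because it is the
    right end of the preceding element of [P]. *)
Lemma offset_cover (T : finType) (P : pred T) (p : T -> R) (x : R) :
  (forall s, 0 <= p s) -> 0 <= x < \sum_(s | P s) p s ->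
  exists2 t, P t & offset P p t <= x < offset P p t + p t.
Proof.
move=> p0 /andP[x0 xs].
have [t0 /andP[Pt0 xt0]] : exists t, P t && (x < offset P p t + p t).
  apply/existsP; rewrite -[[exists _, _]]negbK negb_exists; apply/negP =>
      /forallP h.
  have {}h t : P t -> offset P p t + p t <= x.
    by move=> Pt; move: (h t); rewrite Pt /= -leNgt.
  have [t1 Pt1|none] := pickP P; last first.
    by move: xs; rewrite big_pred0 // ltNge x0.
  case: (arg_maxnP (fun t => enum_rank t : nat) Pt1) => t Pt tmax.
  move: xs; rewrite ltNge; apply/negP; rewrite negbK; apply: le_trans (h t Pt).
  rewrite (bigID (fun s => (enum_rank s < enum_rank t)%N)) /= lerD2l.
  rewrite (bigD1 t) /= ?Pt ?ltnn // big1 ?addr0 // => s /andP[/andP[Ps]].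
  rewrite -leqNgt => ts st; case/eqP: st; apply: enum_rank_inj; apply: val_inj.
  by apply/eqP; rewrite eqn_leq ts andbT; exact: tmax.
case: (arg_minnP (fun t => enum_rank t : nat) (P := fun t =>
    P t && (x < offset P p t + p t))
  (i0 := t0)) => [|t /andP[Pt xt] tmin]; first by rewrite Pt0.
exists t => //; rewrite xt andbT leNgt; apply/negP => xo.
have [s0 /andP[Ps0 st0]|none] := pickP (fun s =>
    P s && (enum_rank s < enum_rank t)%N); last first.
  by move: xo; rewrite /offset big_pred0 // ltNge x0.
case: (arg_maxnP (fun t => enum_rank t : nat) (P := fun s =>
    P s && (enum_rank s < enum_rank t)%N)
  (i0 := s0)) => [|s /andP[Ps st] smax]; first by rewrite Ps0.
have : P s && (x < offset P p s + p s).
  rewrite Ps /=; apply: (lt_le_trans xo).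
  rewrite /offset (bigD1 s) ?Ps //= addrC lerD2r [leLHS]big_mkcond
      [leRHS]big_mkcond /=.
  apply: ler_sum => u _; case Pu : (P u) => //=.
  have [ut|ut] /= := ltnP (enum_rank u) (enum_rank t); last by case: ifP.
  case: eqP => [->|us] /=; first by rewrite ltnn.
  have : (enum_rank u <= enum_rank s)%N by apply: smax; rewrite Pu.
  by rewrite leq_eqVlt => /orP[/eqP/val_inj/enum_rank_inj //|->].
by move/tmin; rewrite leqNgt st.
Qed.

Variables (T : nat -> finType) (r : forall n, T n.+1 -> T n).
Variable p : forall n, T n -> R.
Hypothesis p_ge0 : forall n t, 0 <= @p n t.
Hypothesis p_total : \sum_(t : T 0%N) p t = 1.
Hypothesis p_marginal : forall n (t : T n), \sum_(s | r s == t) p s = p t.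

Fixpoint left_end (n : nat) : T n -> R :=
  match n with
  | 0 => fun t => offset predT (@p 0) t
  | n'.+1 => fun s => left_end (r s) + offset (fun s' =>
      r s' == r s) (@p n'.+1) s
  end.

(** Half-open, so that the slots of one level tile [0, 1) disjointly and the slot of a [t] with
    [p t = 0] is empty. *)
Definition slot n (t : T n) : set R := `[left_end t, left_end t + p t[.

Lemma slot_sub n (s : T n.+1) : slot s `<=` slot (r s).
Proof.
move=> x; rewrite /slot /= !in_itv /= => /andP[h1 h2].
have o0 := @offset_ge0 _ (fun s' => r s' == r s) (@p n.+1) s (@p_ge0 n.+1).
have := @offset_le _ (fun s' => r s' == r s) (@p n.+1) s (eqxx _) (@p_ge0 n.+1).
by rewrite p_marginal => h3; apply/andP; split; lra.
Qed.

Lemma slot_disj n (s t : T n) x : slot s x -> slot t x -> s = t.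
Proof.
elim: n s t => [|n IH] s t sx tx.
  apply/eqP/negPn/negP => st.
  have : (enum_rank s != enum_rank t :> nat).
    by apply: contra st => /eqP/val_inj/enum_rank_inj ->.
  move: sx tx; rewrite /slot /= !in_itv /= => /andP[s1 s2] /andP[t1 t2].
  rewrite neq_ltn => /orP[] h.
    by have := @offset_lt _ predT (@p 0) s t isT (@p_ge0 0) h; lra.
  by have := @offset_lt _ predT (@p 0) t s isT (@p_ge0 0) h; lra.
have E := IH _ _ (slot_sub sx) (slot_sub tx).
apply/eqP/negPn/negP => st.
have : (enum_rank s != enum_rank t :> nat).
  by apply: contra st => /eqP/val_inj/enum_rank_inj ->.
move: sx tx; rewrite /slot /= !in_itv /= E => /andP[s1 s2] /andP[t1 t2].
rewrite neq_ltn => /orP[] h.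
  by have := @offset_lt _ (fun s' => r s' == r t) (@p n.+1) s t (introT eqP E)
      (@p_ge0 _) h; lra.
by have := @offset_lt _ (fun s' => r s' == r t) (@p n.+1) t s (eqxx _) (@p_ge0
    _) h; lra.
Qed.

Lemma slot_cover n x : 0 <= x < 1 -> exists t : T n, slot t x.
Proof.
move=> x01; elim: n => [|n [t]].
  have [|t _ h] := @offset_cover _ predT (@p 0) x (@p_ge0 0).
    by rewrite p_total.
  by exists t; rewrite /slot /= in_itv.
rewrite /slot /= in_itv /= => /andP[h1 h2].
have [|s /eqP rs /andP[h3 h4]] :=
    @offset_cover _ (fun s => r s == t) (@p n.+1) (x - left_end t) (@p_ge0 _).
  by rewrite p_marginal; apply/andP; split; lra.
by exists s; rewrite /slot /= in_itv /= rs; apply/andP; split; lra.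
Qed.

Lemma slot_unit n (t : T n) : slot t `<=` `[0, 1[.
Proof.
elim: n t => [|n IH] t x tx; last exact: IH (slot_sub tx).
move: tx; rewrite /slot /= !in_itv /= => /andP[h1 h2].
have o0 := @offset_ge0 _ predT (@p 0) t (@p_ge0 0).
have := @offset_le _ predT (@p 0) t isT (@p_ge0 0); rewrite p_total => h3.
by apply/andP; split; lra.
Qed.

Lemma measurable_slot n (t : T n) : measurable (slot t).
Proof. exact: measurable_itv. Qed.

Lemma lebesgue_slot n (t : T n) : lebesgue_measure (slot t) = (p t)%:E.
Proof.
rewrite /slot lebesgue_measure_itv /= lte_fin ltrDl -EFinB addrC addKr.
by case: ltgtP (p_ge0 t) => // <-.
Qed.

End Nested.

Lemma uniform_prob01 (R : realType) (A : set R) :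
  measurable A -> (A `<=` `[0, 1[)%classic ->
  uniform_prob (@ltr01 R) A = lebesgue_measure A.
Proof.
move=> mA A01; rewrite /uniform_prob -[RHS]mul1e -integral_cst //.
apply: eq_integral => x /set_mem /A01 /=; rewrite in_itv /= => /andP[x0 x1].
by rewrite /uniform_pdf ?in_itv /= x0 (ltW x1) /= subr0 invr1.
Qed.

(** * Compatibility of the finite Gibbs measures *)

Section Tree.
Variable k : nat.
Implicit Types x y : vertex k.

(** Total: the root is its own parent. A tail of a reduced word is reduced, so the default of
    [insubd] never interferes. *)
Definition parent y : vertex k := insubd tree_root (behead (word y)).

Lemma word_parent y : word (parent y) = behead (word y).
Proof.
rewrite /parent /insubd insubT //; case: y => -[|a w] //= h.
by move: h; rewrite /reduced /=; exact: path_sorted.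
Qed.

Lemma childE x y : child x y = (y != tree_root) && (x == parent y).
Proof.
apply/childP/andP => [[a E]|[yr /eqP ->]].
  split; first by apply/eqP => yr; move: E; rewrite yr.
  by apply/eqP/val_inj; rewrite /= word_parent E.
rewrite word_parent; case E : (word y) yr => [|a w] yr; last by exists a.
by case/eqP: yr; apply: val_inj.
Qed.

Lemma depth_parent y : depth (parent y) = (depth y).-1.
Proof. by rewrite /depth word_parent size_behead. Qed.

Lemma root_depth y : (y == tree_root) = (depth y == 0%N).
Proof.
by apply/eqP/eqP => [->//|/size0nil E]; apply: val_inj.
Qed.

Lemma children x : x != tree_root -> exists s : seq (vertex k),
  [/\ uniq s, size s = k & forall y, (y \in s) = child x y].
Proof.
move=> xr; have [y yx] := parent_exists xr.
have [s [us ss sP]] := adj_degree x.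
have ys : y \in s by rewrite sP /adj yx orbT.
exists (rem y s); split; first exact: rem_uniq.
  by rewrite size_rem // ss.
move=> u; rewrite mem_rem_uniq // inE sP /adj.
have [->|uy] /= := eqVneq u y.
  by apply/esym/negbTE/negP => xy; move: (child_depth yx) (child_depth xy); lia.
have -> : child u x = false; last by rewrite orbF.
by apply: contraNF uy => ux; rewrite (parent_uniq ux yx).
Qed.

Lemma ball_sub n m x : (n <= m)%N -> x \in ball_V k n -> x \in ball_V k m.
Proof. by rewrite !in_ball_V => nm xn; apply: leq_trans nm. Qed.

Lemma big_ballS (R : comNzRingType) n (P : pred (vertex k)) (F : vertex k ->
    R) :
  \prod_(y <- ball_V k n.+1 | P y && (depth y <= n)%N) F y =
  \prod_(y <- ball_V k n | P y) F y.
Proof.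
rewrite -big_filter -[RHS]big_filter; apply: perm_big; apply: uniq_perm;
  rewrite ?filter_uniq ?fset_uniq // => y.
rewrite !mem_filter !in_ball_V -andbA; congr (_ && _).
by case: leqP => //= h; rewrite ltnW.
Qed.

(** Reading [s] at arbitrary vertices, with a dummy value outside the ball, lets balls of different
    radii be compared without membership proofs. *)
Definition spin_at n (s : {ffun ball_V k n -> spin}) x : spin :=
  if insub x is Some b then s b else ord0.

Lemma spin_atE n (s : {ffun ball_V k n -> spin}) (x : ball_V k n) :
  spin_at s (val x) = s x.
Proof. by rewrite /spin_at valK. Qed.

Definition restr n m (s : {ffun ball_V k m -> spin}) : {ffun ball_V k n ->
    spin} :=
  [ffun x => spin_at s (val x)].

Lemma spin_at_restr n m (s : {ffun ball_V k m -> spin}) x : (depth x <= n)%N ->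
  spin_at (restr n s) x = spin_at s x.
Proof.
by rewrite -in_ball_V => h; rewrite -[x]/(val [` h]%fset) spin_atE ffunE.
Qed.

Lemma spin_at_inj n (s t : {ffun ball_V k n -> spin}) :
  (forall x, (depth x <= n)%N -> spin_at s x = spin_at t x) -> s = t.
Proof.
move=> h; apply/ffunP => x; rewrite -!spin_atE h // -in_ball_V; exact: valP.
Qed.

Lemma extendsE n (s : {ffun ball_V k n.+1 -> spin}) (t : {ffun ball_V k n ->
    spin}) :
  extends s t = (restr n s == t).
Proof.
apply/forallP/eqP => [h|<- x].
  apply/ffunP => x; rewrite ffunE.
  have xn := ball_sub (leqnSn n) (valP x).
  rewrite -[val x]/(val [` xn]%fset) spin_atE.
  by have /forallP/(_ [` xn]%fset)/implyP/(_ (eqxx _))/eqP := h x.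
by apply/forallP => y; apply/implyP => /eqP xy; rewrite ffunE xy spin_atE.
Qed.

Lemma finite_configP n (s : {ffun ball_V k n -> spin}) :
  reflect (forall x y, (depth x <= n)%N -> (depth y <= n)%N -> adj x y ->
     allowed (spin_at s x) (spin_at s y)) (s \in finite_config (ball_V k n)).
Proof.
rewrite inE; apply: (iffP forallP) => [h x y xn yn xy|h x].
  rewrite -in_ball_V in xn; rewrite -in_ball_V in yn.
  have /forallP/(_ [` yn]%fset)/implyP/(_ xy) := h [` xn]%fset.
  by rewrite -!spin_atE.
apply/forallP => y; apply/implyP => xy; rewrite -!spin_atE; apply: h => //;
  rewrite -in_ball_V; exact: valP.
Qed.

Lemma finite_config_restr n m (s : {ffun ball_V k m -> spin}) : (n <= m)%N ->
  s \in finite_config (ball_V k m) -> restr n s \in finite_config (ball_V k n).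
Proof.
move=> nm /finite_configP h; apply/finite_configP => x y xn yn xy.
by rewrite !spin_at_restr //; apply: h => //; apply: leq_trans nm.
Qed.

Lemma allowed_sym i j : allowed i j = allowed j i.
Proof. by rewrite /allowed distnC. Qed.

Lemma const_config n i : [ffun=> i] \in finite_config (ball_V k n).
Proof.
by rewrite inE; apply/forallP => x; apply/forallP => y;
    rewrite !ffunE /allowed distnn implybT.
Qed.

End Tree.

(** * Weights and the summation over the outermost sphere *)

Section Weight.
Variables (k : nat) (R : realType) (theta : R).
Hypothesis theta_gt0 : 0 < theta.

(** An edge is determined by its endpoint farther from the root, so the product over edges is a
    product over non-root vertices. *)
Lemma edges_spin_at n (s : {ffun ball_V k n -> spin}) :
  \prod_(x : ball_V k n) \prod_(y : ball_V k n | child (val x) (val y))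
     activity theta (s x) (s y) =
  \prod_(y <- ball_V k n | y != tree_root)
     activity theta (spin_at s (parent y)) (spin_at s y).
Proof.
rewrite (exchange_big_dep predT) //= big_seq_fsetE /= [RHS]big_mkcond /=.
apply: eq_bigr => y _; rewrite spin_atE.
have [yr|yr] := eqVneq (val y) tree_root.
  by rewrite big_pred0 // => x; rewrite childE yr eqxx.
have pn : parent (val y) \in ball_V k n.
  by have := valP y; rewrite !in_ball_V depth_parent; apply: leq_trans;
      exact: leq_pred.
rewrite (big_pred1 [` pn]%fset) => [|x]; first by rewrite -spin_atE.
by rewrite childE yr -val_eqE.
Qed.

Lemma weight_spin_at (z : vertex k -> spin -> R) n (s : {ffun ball_V k n ->
    spin}) :
  weight theta z s = \prod_(y <- ball_V k n | y != tree_root)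
     activity theta (spin_at s (parent y)) (spin_at s y) *
  \prod_(x <- ball_V k n | depth x == n) z x (spin_at s x).
Proof.
rewrite /weight edges_spin_at [in RHS](big_seq_fsetE _ _ (fun x =>
    depth x == n)) /=.
by congr (_ * _); apply: eq_bigr => x _; rewrite spin_atE.
Qed.

Lemma activity_ge0 i j : 0 <= activity theta i j.
Proof. by rewrite /activity; case: ifP => // _; case: ifP => // _;
    exact: ltW. Qed.

Lemma activity_eq0 i j : ~~ allowed i j -> activity theta i j = 0.
Proof.
by rewrite /activity; case: eqP => [->|_ /negPf -> //]; rewrite /allowed distnn.
Qed.

Lemma weight_ge0 (z : vertex k -> spin -> R) n (s : {ffun ball_V k n -> spin}) :
  (0 < n)%N -> (forall x, x != tree_root -> forall i, 0 < z x i) ->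
  0 <= weight theta z s.
Proof.
move=> n0 zp; rewrite weight_spin_at mulr_ge0 // prodr_ge0 // =>
    [y _|x /eqP xn].
  exact: activity_ge0.
by apply/ltW/zp; rewrite root_depth xn -lt0n.
Qed.

(** A forbidden edge contributes a factor 0. Sums over admissible configurations may therefore be
    extended to all configurations. *)
Lemma weight_eq0 (z : vertex k -> spin -> R) n (s : {ffun ball_V k n -> spin}) :
  s \notin finite_config (ball_V k n) -> weight theta z s = 0.
Proof.
move=> sn; have [x [y [xy nxy]]] : exists x y : ball_V k n,
    child (val x) (val y) /\ ~~ allowed (s x) (s y).
  move: sn; rewrite inE negb_forall => /existsP[x]; rewrite negb_forall =>
      /existsP[y].
  rewrite negb_imply => /andP[/orP[] xy nxy]; first by exists x, y.
  by exists y, x; rewrite allowed_sym.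
by rewrite /weight (bigD1 x) //= (bigD1 y) //= activity_eq0 // !mul0r.
Qed.

Lemma weight_const (z : vertex k -> spin -> R) z0 n i : (0 < n)%N ->
  (forall x, x != tree_root -> z x = z0) ->
  weight theta z [ffun _ : ball_V k n => i] =
  z0 i ^+ count (fun x => depth x == n) (ball_V k n).
Proof.
move=> n0 zE; rewrite /weight big1 ?mul1r => [|x _]; last first.
  by rewrite big1 // => y _; rewrite !ffunE /activity eqxx.
rewrite -iter_mulr_1 -big_const_seq big_seq_fsetE /=.
apply: eq_bigr => x /eqP xn; rewrite ffunE zE //.
by rewrite root_depth xn -lt0n.
Qed.

Lemma weight_ext (z z' : vertex k -> spin -> R) n (s : {ffun ball_V k n ->
    spin}) :
  (0 < n)%N -> (forall x, x != tree_root -> z x = z' x) ->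
  weight theta z s = weight theta z' s.
Proof.
move=> n0 zE; congr (_ * _); apply: eq_bigr => x /eqP xn; rewrite zE //.
by rewrite root_depth xn -lt0n.
Qed.

Lemma partition_gt0 (z : vertex k -> spin -> R) n : (0 < n)%N ->
  (forall x, x != tree_root -> forall i, 0 < z x i) ->
  0 < partition_function theta z n.
Proof.
move=> n0 zp; rewrite /partition_function (bigD1 [ffun=> ord0]) ?const_config
    //=.
apply: ltr_wpDr; first by apply: sumr_ge0 => s _; exact: weight_ge0.
rewrite /weight mulr_gt0 //; apply: prodr_gt0 => x; first move=> _.
  by apply: prodr_gt0 => y _; rewrite !ffunE /activity eqxx.
by move/eqP => xn; apply: zp; rewrite root_depth xn -lt0n.
Qed.

(** The total weight that one child on the boundary sphere contributes to a parent of spin [i]. *)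
Definition transfer (z : spin -> R) (i : spin) : R :=
  \sum_j activity theta i j * z j.

(** Given [t], the spins on the outer sphere are independent, so the sum of products is a product of
    sums, one [transfer] factor per outer vertex. Grouping outer vertices by parent gives the power
    [k]; [0 < n] keeps the root, which has k+1 children, off the sphere. *)
Lemma sum_extends (z : spin -> R) n (t : {ffun ball_V k n ->
    spin}) : (0 < n)%N ->
  \sum_(s in finite_config (ball_V k n.+1) | extends s t) weight theta (fun=>
      z) s =
  \prod_(y <- ball_V k n | y != tree_root)
     activity theta (spin_at t (parent y)) (spin_at t y) *
  \prod_(x <- ball_V k n | depth x == n) transfer z (spin_at t x) ^+ k.
Proof.
move=> n0.
(* [Q] frees the outer spins and pins the inner ones to [t], so [family Q] consists of all
   extensions of [t], admissible or not; [F] collects the factors of an outer vertex. *)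
pose F (y : ball_V k n.+1) j : R := if depth (val y) == n.+1
  then activity theta (spin_at t (parent (val y))) j * z j else 1.
pose Q (y : ball_V k n.+1) j := (depth (val y) == n.+1) ||
    (j == spin_at t (val y)).
have famE s : (s \in family Q) = extends s t.
  rewrite extendsE; apply/familyP/eqP => [h|E y].
    apply: spin_at_inj => x xn; rewrite spin_at_restr //.
    have xn1 : x \in ball_V k n.+1 by rewrite in_ball_V ltnW.
    have /orP[/= /eqP E|/eqP] := h [` xn1]%fset; first by move: xn;
        rewrite E ltnn.
    by rewrite -spin_atE.
  rewrite unfold_in /Q; case: eqP => //= yn; rewrite -E spin_at_restr ?spin_atE
      //.
  by have := valP y; rewrite in_ball_V leq_eqVlt => /orP[/eqP //|].
have -> : \sum_(s in finite_config (ball_V k n.+1) | extends s t)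
    weight theta (fun=> z) s = \sum_(s in family Q) weight theta (fun=> z) s.
  rewrite [LHS]big_mkcond [RHS]big_mkcond; apply: eq_bigr => s _; rewrite famE.
  by case: (boolP (s \in finite_config _)) => //= /weight_eq0 ->; case: ifP.
transitivity (\sum_(s in family Q) \prod_(y <- ball_V k n | y != tree_root)
    activity theta (spin_at t (parent y)) (spin_at t y) * \prod_y F y (s y)).
  apply: eq_bigr => s; rewrite famE extendsE => /eqP st.
  have stE x : (depth x <= n)%N -> spin_at s x = spin_at t x.
    by move=> xn; rewrite -st spin_at_restr.
  rewrite weight_spin_at (bigID (fun y => depth y <= n)%N) /= big_ballS -mulrA.
  apply: (congr2 *%R).
    rewrite big_seq_cond [RHS]big_seq_cond; apply: eq_bigr => y /andP[yn _].
    rewrite in_ball_V in yn; rewrite !stE // depth_parent.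
    exact: leq_trans (leq_pred _) yn.
  have -> : \prod_y F y (s y) = \prod_(y <- ball_V k n.+1 | depth y == n.+1)
      (activity theta (spin_at t (parent y)) (spin_at s y) * z (spin_at s y)).
    rewrite [RHS]big_seq_fsetE [RHS]big_mkcond /=; apply: eq_bigr => y _.
    by rewrite /F spin_atE.
  rewrite big_split /=; apply: (congr2 *%R); last by [].
  rewrite big_seq_cond [RHS]big_seq_cond; apply: eq_big =>
      [y|y /andP[yn /andP[_ yd]]].
    rewrite root_depth in_ball_V; move: (depth y) => d.
    case: (ltngtP d n.+1) => [h|h|->] //=; last by rewrite ltnn.
    by rewrite (h : (d <= n)%N) !andbF.
  by rewrite stE // depth_parent; move: yn; rewrite in_ball_V; case: (depth y).
rewrite -big_distrr /= -bigA_distr_big_dep; congr (_ * _).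
have -> : \prod_i \sum_(j | Q i j) F i j =
    \prod_(y <- ball_V k n.+1 | depth y == n.+1) transfer z (spin_at t (parent
        y)).
  rewrite [RHS]big_seq_fsetE [RHS]big_mkcond /=; apply: eq_bigr => y _.
  rewrite /F /Q; case: eqP => // _; rewrite (big_pred1 (spin_at t (val y))) //.
have -> : \prod_(x <- ball_V k n | depth x == n) transfer z (spin_at t x) ^+ k =
   \prod_(x : ball_V k n | depth (val x) == n)
   \prod_(y : ball_V k n.+1 | child (val x) (val y)) transfer z (spin_at t (val
       x)).
  rewrite big_seq_fsetE /=; apply: eq_bigr => x /eqP xn.
  rewrite -(big_seq_fsetE _ _ (child (val x)) (fun=> transfer z (spin_at t (val
      x)))).
  have xr : val x != tree_root by rewrite root_depth xn -lt0n.
  have [s [us ss sP]] := children xr.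
  rewrite -big_filter (perm_big s) /=.
    by rewrite big_const_seq count_predT ss iter_mulr_1.
  apply: uniq_perm; rewrite ?filter_uniq ?fset_uniq // => y.
  rewrite mem_filter sP in_ball_V; case xy: child => //=.
  by rewrite (child_depth xy) xn leqnn.
rewrite big_seq_fsetE /= (exchange_big_dep (fun y : ball_V k n.+1 =>
    depth (val y) == n.+1)) /=.
  apply: eq_bigr => y /eqP yn.
  have pn : parent (val y) \in ball_V k n by rewrite in_ball_V depth_parent yn.
  rewrite (big_pred1 [` pn]%fset) // => x.
  have yr : val y != tree_root by rewrite root_depth yn.
  rewrite childE yr /= -[RHS](inj_eq val_inj) /=; apply: andb_idl => /eqP ->.
  by rewrite depth_parent yn.
by move=> x y /eqP xn /child_depth E; rewrite E xn.
Qed.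

Lemma partition_restr (z : vertex k -> spin -> R) n :
  partition_function theta z n.+1 =
  \sum_(t in finite_config (ball_V k n))
    \sum_(s in finite_config (ball_V k n.+1) | extends s t) weight theta z s.
Proof.
rewrite /partition_function (partition_big (fun s =>
    restr n s) (mem (finite_config (ball_V k n)))) /=.
  by apply: eq_bigr => t _; apply: eq_bigl => s; rewrite extendsE.
by move=> s; exact: finite_config_restr.
Qed.

Definition sphere_size n := count (fun x => depth x == n) (ball_V k n).

Lemma sphere1_gt0 : (0 < sphere_size 1)%N.
Proof.
have [|y Ey] := @child_exists k tree_root ord0; first by [].
rewrite -has_count; apply/hasP; exists y; last by rewrite /depth Ey.
by rewrite in_ball_V /depth Ey.
Qed.

Lemma transfer_gt0 (z : spin -> R) i : (forall i, 0 < z i) -> 0 < transfer z i.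
Proof.
move=> zp; rewrite /transfer (bigD1 i) //= ltr_wpDr //.
  by apply: sumr_ge0 => j _; rewrite mulr_ge0 ?activity_ge0 // ltW.
by rewrite /activity eqxx mul1r.
Qed.

(** Forward: compatibility between radii 2 and 1 at the constant configuration [i] says that the
    power [sphere_size 1] of [transfer z i ^+ k / z i] is the ratio of partition functions, and
    positive roots are unique. Backward: summing out a sphere multiplies every weight by the same
    power of [r], which cancels in the normalization. *)
Lemma compatible_constant (z : spin -> R) : (forall i, 0 < z i) ->
  compatible theta (fun _ : vertex k => z) <->
  exists r, forall i, transfer z i ^+ k = r * z i.
Proof.
move=> zp; have zp' (x : vertex k) : x != tree_root -> forall i, 0 < z i by [].
split=> [cmp|[r rE] [//|[//|n]] _ t tn /=].
  pose q i := transfer z i ^+ k / z i.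
  have q0 i : 0 < q i by rewrite divr_gt0 ?exprn_gt0 ?transfer_gt0.
  suff qE i : q i ^+ sphere_size 1 =
      partition_function theta (fun _ : vertex k => z) 2%N /
      partition_function theta (fun _ : vertex k => z) 1%N.
    exists (q ord0) => i; suff -> : q ord0 = q i by rewrite divfK // gt_eqF.
    apply: (@pexpIrn _ (sphere_size 1)); rewrite ?sphere1_gt0 ?nnegrE ?ltW //.
    by rewrite !qE.
  have := cmp 2%N isT [ffun=> i] (const_config k 1 i).
  rewrite /finite_gibbs -big_distrl /= sum_extends //.
  rewrite (weight_const (z0 := z)) //.
  have tE x : x \in ball_V k 1%N -> spin_at [ffun _ : ball_V k 1%N => i] x = i.
    by move=> x1; rewrite -[x]/(val [` x1]%fset) spin_atE ffunE.
  have -> : \prod_(y <- ball_V k 1%N | y != tree_root) activity theta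
     (spin_at [ffun _ : ball_V k 1%N => i] (parent y)) (spin_at [ffun _ :
         ball_V k 1%N => i] y) = 1.
    rewrite big_seq_cond big1 // => y /andP[y1 _].
    have p1 : parent y \in ball_V k 1.
      by move: y1; rewrite !in_ball_V depth_parent; apply: leq_trans;
          exact: leq_pred.
    by rewrite !tE // /activity eqxx.
  have -> : \prod_(x <- ball_V k 1%N | depth x == 1%N)
      transfer z (spin_at [ffun _ : ball_V k 1%N => i] x) ^+ k =
      (transfer z i ^+ k) ^+ sphere_size 1.
    rewrite -iter_mulr_1 -big_const_seq big_seq_cond [RHS]big_seq_cond.
    by apply: eq_bigr => x /andP[x1 _]; rewrite tE.
  have Z1 := partition_gt0 (n := 1%N) isT zp'; have Z2 := partition_gt0 (n :=
      2%N) isT zp'.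
  rewrite mul1r => /eqP; rewrite eqr_div ?lt0r_neq0 // => /eqP E.
  rewrite /q expr_div_n; apply/eqP; rewrite eqr_div ?lt0r_neq0 ?exprn_gt0 //.
  by rewrite E mulrC.
have r0 : r != 0.
  apply/eqP => r0; have := rE ord0; rewrite r0 mul0r => /eqP.
  by rewrite gt_eqF // exprn_gt0 // transfer_gt0.
have sumE (u : {ffun ball_V k n.+1 -> spin}) :
   \sum_(s in finite_config (ball_V k n.+2) | extends s u)
     weight theta (fun=> z) s = r ^+ sphere_size n.+1 * weight theta (fun=> z)
         u.
  rewrite sum_extends // weight_spin_at mulrCA; congr (_ * _).
  rewrite -iter_mulr_1 -big_const_seq -big_split /=.
  by apply: eq_bigr => x _; rewrite rE.
rewrite /finite_gibbs -big_distrl /= sumE partition_restr.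
under [X in _ / X]eq_bigr do rewrite sumE.
by rewrite -big_distrr /= -mulf_div divff ?mul1r // expf_neq0.
Qed.

End Weight.

(** * Measures on the space of configurations *)

Section Cylinders.
Local Open Scope classical_set_scope.
Variable k : nat.

Definition window n (c : config k) : {ffun ball_V k n -> spin} :=
  [ffun x => c (val x)].

Lemma spin_at_window n (c : config k) x : (depth x <= n)%N ->
    spin_at (window n c) x = c x.
Proof.
by rewrite -in_ball_V => h; rewrite -[x]/(val [` h]%fset) spin_atE ffunE.
Qed.

Lemma cylinderE n (t : {ffun ball_V k n -> spin}) :
  cylinder t = [set c : config k | window n c = t].
Proof.
apply/seteqP; split => [c h|c <- x] /=; last by rewrite ffunE.
by apply/ffunP => x; rewrite ffunE h.
Qed.

Lemma window_config n c : window n c \in finite_config (ball_V k n).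
Proof.
apply/finite_configP => x y xn yn xy; rewrite !spin_at_window //.
exact: config_allowed.
Qed.

Lemma measurable_cylinder n (t : {ffun ball_V k n -> spin}) :
  measurable (cylinder t : set (configs k)).
Proof.
have -> : (cylinder t : set (configs k)) =
    \bigcap_(x in [set: ball_V k n]) [set c : config k | c (val x) = t x].
  by apply/seteqP; split => [c h x _|c h x]; exact: h.
apply: fin_bigcap_measurable; first exact: finite_finset.
by move=> x _; apply: sub_sigma_algebra; exists (val x), (t x).
Qed.

(** The empty set gives closure under intersection, and the full set serves as the exhausting
    sequence in the uniqueness theorem for measures. Radius 0 is excluded since the finite Gibbs
    measures start at radius 1. *)
Definition cylinder_system : set (set (config k)) :=
  [set A | [\/ A = set0, A = setT |
    exists n (t : {ffun ball_V k n -> spin}), (0 < n)%N /\ A = cylinder t]].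

(** Two cylinders sharing a configuration are both cylinders of its windows, so the one over the
    larger ball is contained in the other. *)
Lemma cylinder_systemI : setI_closed cylinder_system.
Proof.
move=> A B [->|->|[n [t [n0 ->]]]]; first by rewrite set0I; constructor 1.
  by rewrite setTI.
case=> [->|->|[m [u [m0 ->]]]]; first by rewrite setI0; constructor 1.
  by rewrite setIT; constructor 3; exists n, t.
have [->|/set0P[c [ct cu]]] := eqVneq (cylinder t `&` cylinder u) set0.
  by constructor 1.
constructor 3; move: ct cu; rewrite !cylinderE /= => <- <-.
have shrink i j d : (i <= j)%N -> window j d = window j c -> window i d =
    window i c.
  move=> ij E; apply: spin_at_inj => x xi.
  have xj := leq_trans xi ij.
  by rewrite !spin_at_window // -(spin_at_window d xj) E spin_at_window.
have [nm|mn] := leqP n m.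
  exists m, (window m c); split => //; rewrite cylinderE; apply/seteqP;
      split => d /=.
    by case.
  by move=> E; split => //; exact: shrink E.
exists n, (window n c); split => //; rewrite cylinderE; apply/seteqP;
    split => d /=.
  by case.
by move=> E; split => //; apply: shrink E; exact: ltnW.
Qed.

(** The radius is one more than the depth so that it is positive even for the root. *)
Lemma coordinate_cylinders (x : vertex k) i :
  [set s : config k | s x = i] = \bigcup_(t in [set t : {ffun ball_V k (depth
      x).+1 -> spin} |
     spin_at t x = i]) cylinder t.
Proof.
apply/seteqP; split => [c cx|c [t tx]] /=.
  by exists (window (depth x).+1 c); rewrite ?cylinderE //= spin_at_window.
by rewrite cylinderE /= => ct; rewrite -tx -ct spin_at_window.
Qed.

Lemma measurable_cylinder_system :
  @measurable _ (configs k) = <<s cylinder_system >>.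
Proof.
apply/seteqP; split; apply: smallest_sub.
- exact: smallest_sigma_algebra.
- move=> _ [x [i ->]]; rewrite coordinate_cylinders.
  apply: (@fin_bigcup_measurable _ (g_sigma_algebraType cylinder_system)).
    exact: finite_finset.
  move=> t _; apply: sub_sigma_algebra; constructor 3.
  by exists (depth x).+1, t.
- exact: sigma_algebra_measurable.
move=> _ [->|->|[n [t [_ ->]]]]; [exact: measurable0|exact: measurableT|].
exact: measurable_cylinder.
Qed.

Lemma same_measure_cylinders (R : realType) (mu nu : probability (configs k) R)
    :
  (forall n, (0 < n)%N -> forall t, t \in finite_config (ball_V k n) ->
     mu (cylinder t) = nu (cylinder t)) -> same_measure mu nu.
Proof.
move=> h A mA; apply: (@measure_unique _ R (configs k) cylinder_system (fun=>
    setT)) => //.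
- exact: measurable_cylinder_system.
- exact: cylinder_systemI.
- by move=> _; constructor 2.
- by rewrite bigcup_const //; exists 0%N.
- move=> B [->|->|[n [t [n0 ->]]]]; first by rewrite !measure0.
    by transitivity (1%:E : \bar R); [|apply/esym]; exact: probability_setT.
  have [tn|tn] := boolP (t \in finite_config (ball_V k n)); first exact: h.
  suff -> : (cylinder t : set (configs k)) = set0 by rewrite !measure0.
  rewrite cylinderE -subset0 => c /= E.
  by move: tn; rewrite -E window_config.
- by move=> _; apply: (@le_lt_trans _ _ 1%E); [exact: probability_le1|exact:
    ltry].
Qed.

End Cylinders.

(** * Construction of a measure with given compatible marginals *)

Section Existence.
Local Open Scope classical_set_scope.
Variables (k : nat) (R : realType) (theta : R) (z : vertex k -> spin -> R).
Hypothesis theta_gt0 : 0 < theta.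
Hypothesis z_gt0 : forall x, x != tree_root -> forall i, 0 < z x i.
Hypothesis z_compatible : compatible theta z.

(** Level [n] is the ball of radius n+1, since the Gibbs weights make sense from radius 1 on.
    Inadmissible configurations are kept, with mass 0. *)
Let T n : finType := {ffun ball_V k n.+1 -> spin}.
Let r n (s : T n.+1) : T n := restr n.+1 s.
Let p n (t : T n) : R := finite_gibbs theta z t.

Let p_ge0 n t : 0 <= @p n t.
Proof.
by rewrite /p divr_ge0 ?(weight_ge0 theta_gt0) // ltW // partition_gt0.
Qed.

Let p_total n : \sum_(t : T n) p t = 1.
Proof.
rewrite /p -big_distrl /= (bigID (mem (finite_config (ball_V k n.+1)))) /=.
rewrite [X in _ + X]big1 ?addr0; last by move=> t /(weight_eq0 theta z).
by rewrite divff // gt_eqF // partition_gt0.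
Qed.

Let p_eq0 n (t : T n) : t \notin finite_config (ball_V k n.+1) -> p t = 0.
Proof. by move=> h; rewrite /p /finite_gibbs weight_eq0 ?mul0r. Qed.

Let p_marginal n (t : T n) : \sum_(s | r s == t) p s = p t.
Proof.
have [tn|tn] := boolP (t \in finite_config (ball_V k n.+1)); last first.
  rewrite (p_eq0 tn) big1 // => s /eqP E; apply: p_eq0.
  by apply: contra tn => sn; rewrite -E; apply: finite_config_restr.
rewrite /p -(z_compatible (n := n.+2)) //=.
rewrite [LHS]big_mkcond [RHS]big_mkcond; apply: eq_bigr => s _.
rewrite extendsE -/(r s); case: (boolP (s \in _)) => //= sn.
by rewrite -/(p s) (p_eq0 sn); case: ifP.
Qed.

Let Slot n (t : T n) := slot r p t.

(** Decodes [w] into the configuration whose windows have [w] in their slots. Outside [0, 1) no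
    configuration qualifies and the value is [config0 k]. *)
Definition sample (w : measurableTypeR R) : configs k :=
  xget (config0 k) [set c : config k | forall n, Slot (window n.+1 c) w].

Let sampleP w n : 0 <= w < 1 -> Slot (window n.+1 (sample w)) w.
Proof.
move=> w01; rewrite /sample; case: xgetP => [c _ h|none]; first exact: h.
exfalso.
have cover n' : exists t : T n', Slot t w by exact: slot_cover.
pose t n' : T n' := xchoose (cover n').
have tP n' : Slot (t n') w := xchooseP (cover n').
have tr m : restr m.+1 (t m.+1) = t m.
  apply: (slot_disj p_ge0 p_marginal (x := w)) (tP m).
  exact: (slot_sub p_ge0 p_marginal (tP m.+1)).
(* The slots containing [w] are nested, so the spin at [x] is the same at every level whose ball
   contains [x]. Level [m] has radius m+1, hence the induction starts at [(depth x).-1]. *)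
have tt m x : (depth x <= m.+1)%N -> spin_at (t m) x = spin_at (t (depth x)) x.
  move=> xm; have [j ->] : exists j, m = ((depth x).-1 + j)%N.
    by exists (m - (depth x).-1)%N; lia.
  elim: j => [|j IH].
    rewrite addn0; case E : (depth x) => [|d] //=.
    by rewrite -(tr d) spin_at_restr // E.
  by rewrite addnS -IH -[in RHS]tr spin_at_restr //; lia.
(* Inadmissible configurations have empty slots, so [w] cannot select one. *)
have tadm m : t m \in finite_config (ball_V k m.+1).
  apply/negPn/negP => /p_eq0 E.
  by have := tP m; rewrite /Slot /slot E addr0 set_itvco0.
have cP x y : adj x y ->
    allowed (spin_at (t (depth x)) x) (spin_at (t (depth y)) y).
  move=> xy; pose m := maxn (depth x) (depth y).
  rewrite -(tt m x) -?(tt m y) ?leqW ?leq_maxl ?leq_maxr //.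
  by have /finite_configP := tadm m; apply; rewrite ?leqW ?leq_maxl ?leq_maxr.
apply: (none (Config cP)) => m; suff -> : window m.+1 (Config cP) = t m by [].
by apply: spin_at_inj => x xm; rewrite spin_at_window //= tt.
Qed.

Let sample_slot n (t : T n) w : 0 <= w < 1 -> cylinder t (sample w) <->
  Slot t w.
Proof.
move=> w01; rewrite cylinderE /=; split => [<-|h]; first exact: sampleP.
exact: (slot_disj p_ge0 p_marginal (sampleP n w01) h).
Qed.

Lemma measurable_sample : measurable_fun setT sample.
Proof.
apply: (@measurability _ _ (measurableTypeR R) (configs k) setT sample
    (@coordinate_sets k)) => // _ [_ [x [i ->]] <-].
rewrite setTI coordinate_cylinders preimage_bigcup.
apply: fin_bigcup_measurable; first exact: finite_finset.
move=> t _.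
(* Outside [0, 1) [sample] is constant, so this part of the preimage is either the whole complement
   or empty. *)
have mcyl : measurable (sample @^-1` cylinder t `&` ~` `[0, 1[%classic).
  have [c0|c0] := pselect (cylinder t (config0 k)).
    have -> : sample @^-1` cylinder t `&` ~` `[0, 1[%classic =
        ~` `[0, 1[%classic.
      apply/seteqP; split => [w []//|w w01]; split => //=.
      rewrite /sample; case: xgetP => [c _ /(_ 0%N) h|//].
      by case: w01; exact: (slot_unit p_ge0 (p_total 0) p_marginal h).
    by apply: measurableC; exact: measurable_itv.
  have -> : sample @^-1` cylinder t `&` ~` `[0, 1[%classic = set0.
    rewrite -subset0 => w [] /=; rewrite /sample.
    case: xgetP => [c _ /(_ 0%N) h _ []|//].
    exact: (slot_unit p_ge0 (p_total 0) p_marginal h).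
  exact: measurable0.
have -> : sample @^-1` cylinder t = Slot t `|` (sample @^-1` cylinder t `&` ~`
    `[0, 1[%classic).
  apply/seteqP; split => w.
    move=> h; have [w01|w01] := pselect (`[0, 1[%classic w); last by right.
    by left; apply/sample_slot => //; move: w01; rewrite /= in_itv.
  case=> [h|[]//]; apply/sample_slot => //.
  by have := slot_unit p_ge0 (p_total 0) p_marginal h; rewrite /= in_itv.
by apply: measurableU => //; exact: measurable_slot.
Qed.

HB.instance Definition _ := isMeasurableFun.Build _ _ _ _ sample
    measurable_sample.

Lemma SGM_exists_of_compatible : exists mu : probability (configs k) R,
  forall n, (1 <= n)%N -> forall t, t \in finite_config (ball_V k n) ->
    mu (cylinder t) = (finite_gibbs theta z t)%:E.
Proof.
pose P : probability (measurableTypeR R) R := uniform_prob (@ltr01 R).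
have PE (A : set R) : measurable A -> A `<=` `[0, 1[%classic -> P A =
    lebesgue_measure A.
  exact: uniform_prob01.
exists (distribution P sample) => -[//|n] _ t tn.
transitivity (P (sample @^-1` cylinder t)); first by [].
have m01 : measurable (`[0, 1[%classic : set R) by exact: measurable_itv.
(* If [t] is a window of [config0 k], the preimage of its cylinder contains the complement of [0,
   1). That null part is split off before comparing with the slot. *)
have P01 : P (~` `[0, 1[%classic) = 0%E.
  rewrite probability_setC // PE // lebesgue_measure_itv /=.
  by rewrite lte_fin ltr01 sube0 subee.
have mpre : measurable (sample @^-1` cylinder t).
  by rewrite -[X in measurable X]setTI; apply: measurable_sample => //;
      exact: measurable_cylinder.
have D0 : P (sample @^-1` cylinder t `\` `[0, 1[%classic) = 0%E.
  apply/eqP; rewrite eq_le measure_ge0 andbT -P01; apply: le_measure.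
  - by rewrite inE; apply: measurableD.
  - by rewrite inE; exact: measurableC.
  - by move=> w [].
transitivity (0 + P (sample @^-1` cylinder t `&` `[0%R, 1%R[%classic))%E.
  by rewrite -D0; exact: measureDI.
rewrite add0e.
have -> : sample @^-1` cylinder t `&` `[0, 1[%classic = Slot t.
  apply/seteqP; split => [w [h w01]|w h].
    by apply/sample_slot => //; move: w01; rewrite /= in_itv.
  have w01 := slot_unit p_ge0 (p_total 0) p_marginal h.
  by split => //; apply/sample_slot => //; move: w01; rewrite /= in_itv.
rewrite PE; first exact: (lebesgue_slot _ p_ge0).
  exact: measurable_slot.
exact: (slot_unit p_ge0 (p_total 0) p_marginal).
Qed.

End Existence.

(** * Solutions with z_0 = 1 *)

Section Diagonal.
Variable R : realType.
Implicit Types a b v x theta : R.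

Definition diag_gap a b : R := 4 * a + 2 * b - a ^+ 3 - a ^+ 2 * (a + b)
  + (a ^+ 3 - a) * (a ^+ 2 + a * b + b ^+ 2).

Lemma diag_gap_gt0 a b : 0 < a < 1 -> 0 < b < 1 -> 0 < diag_gap a b.
Proof.
move=> /andP[a0 a1] /andP[b0 b1].
have a2 : 0 < a ^+ 2 < 1 by rewrite exprn_gt0 // exprn_ilt1 // ltW.
have b2 : 0 < b ^+ 2 < 1 by rewrite exprn_gt0 // exprn_ilt1 // ltW.
have h1 : 0 <= a * (1 - a ^+ 2) by apply: mulr_ge0; lra.
have h2 : 0 < b * (1 - a ^+ 2) by apply: mulr_gt0; lra.
have h3 : 0 <= a * (1 - b ^+ 2) by apply: mulr_ge0; lra.
have h4 : 0 <= a ^+ 3 * (a ^+ 2 + a * b + b ^+ 2).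
  by rewrite !(mulr_ge0, addr_ge0, exprn_ge0) // ltW.
have -> : diag_gap a b = a ^+ 3 * (a ^+ 2 + a * b + b ^+ 2) +
    3 * (a * (1 - a ^+ 2)) + 2 * (b * (1 - a ^+ 2)) + a * (1 - b ^+ 2).
  by rewrite /diag_gap; ring.
lra.
Qed.

(** Expansion around [a] of the numerator of f(b) - f(a) for f(v) = (v^3 - v) / (v^4 - 2). The
    linear coefficient is the numerator of f'(a), so at a critical point in (0, 1) only the negative
    quadratic term survives, which makes that point the maximum on (0, 1). *)
Lemma diag_cross a b :
  (b ^+ 3 - b) * (a ^+ 4 - 2) - (a ^+ 3 - a) * (b ^+ 4 - 2) =
  - (b - a) ^+ 2 * diag_gap a b
  - (b - a) * (a ^+ 6 - 3 * a ^+ 4 + 6 * a ^+ 2 - 2).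
Proof. by rewrite /diag_gap; ring. Qed.

Lemma poly_sign_change (p : {poly R}) a b : a <= b -> p.[a] * p.[b] <= 0 ->
  exists2 x, a <= x <= b & p.[x] = 0.
Proof.
move=> ab pab; wlog pa : p pab / p.[a] <= 0.
  move=> wl; have [|pa] := leP p.[a] 0; first exact: wl.
  have [||x xab] := wl (- p); rewrite ?hornerN ?mulrNN ?oppr_le0 ?(ltW pa) //.
  by move/eqP; rewrite oppr_eq0 => /eqP; exists x.
have [pa0|pa0] := eqVneq p.[a] 0; first by exists a; rewrite ?lexx.
have pb : 0 <= p.[b] by move: pab; rewrite nmulr_rle0 // lt_neqAle pa0.
by have [|x xab /rootP] := poly_ivt ab (p := p); [rewrite pa | exists x].
Qed.

Lemma diag_poly_ivt (theta : R) a b : a <= b ->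
  (theta * (a ^+ 4 - 2) - (a ^+ 3 - a)) *
  (theta * (b ^+ 4 - 2) - (b ^+ 3 - b)) <= 0 ->
  exists2 x, a <= x <= b & theta * (x ^+ 4 - 2) = x ^+ 3 - x.
Proof.
pose p : {poly R} := theta *: ('X^4 - 2%:P) - ('X^3 - 'X).
have pE x : p.[x] = theta * (x ^+ 4 - 2) - (x ^+ 3 - x) by rewrite !hornerE.
move=> ab; rewrite -!pE => /(poly_sign_change ab)[x xab /eqP].
by rewrite pE subr_eq0 => /eqP; exists x.
Qed.

Lemma diag_outer_unique theta a b : 0 < theta -> 1 <= a -> 1 <= b ->
  theta * (a ^+ 4 - 2) = a ^+ 3 - a -> theta * (b ^+ 4 - 2) = b ^+ 3 - b ->
  a = b.
Proof.
move=> t0 a1 b1 ha hb; apply/eqP; apply/negPn/negP => ab.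
have h : (b - a) * (- (a * b) ^+ 3 + (a * b - 2) * (a ^+ 2 + a * b + b ^+ 2) +
    2)
    = 0.
  have -> : (b - a) * (- (a * b) ^+ 3 + (a * b - 2) * (a ^+ 2 + a * b + b ^+ 2)
    + 2) = (b ^+ 3 - b) * (a ^+ 4 - 2) - (a ^+ 3 - a) * (b ^+ 4 - 2) by ring.
  by rewrite -ha -hb; ring.
move/eqP: h; rewrite mulf_eq0 subr_eq0 eq_sym (negPf ab) /= => /eqP h.
(* Let m = ab. If m <= 2, then a^2 + b^2 >= 2m bounds the second factor by -(m - 1)^3 - 3m + 1 < 0.
   If m > 2, then (a^2 - 1)(b^2 - 1) >= 0 gives a^2 + b^2 <= m^2 + 1 and the bound -m^2 - m < 0. *)
have [m2|m2] := leP (a * b) 2.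
  have hq : 0 <= (2 - a * b) * (a - b) ^+ 2.
    by rewrite mulr_ge0 ?sqr_ge0 // subr_ge0.
  have m1 : 1 <= a * b by rewrite -[1]mulr1 ler_pM.
  have : (a * b - 1) ^+ 3 >= 0 by rewrite exprn_ge0 // subr_ge0.
  nra.
have hq : 0 <= (a * b - 2) * ((a ^+ 2 - 1) * (b ^+ 2 - 1)).
  by rewrite !mulr_ge0 ?subr_ge0 ?exprn_ege1 // ltW.
nra.
Qed.

Lemma diag_outer_exists theta : 0 < theta ->
  exists2 v, 1 < v & theta * (v ^+ 4 - 2) = v ^+ 3 - v.
Proof.
(* With this [b], [theta * b = 2 * theta + 1], so [theta * b ^+ 4] exceeds [b ^+ 3] by
   [2 * theta * b ^+ 3], which makes the sign at [b] nonnegative. *)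
move=> t0; pose b := 2 + theta^-1.
have ti : 0 < theta^-1 by rewrite invr_gt0.
have b1 : 1 <= b by rewrite /b; lra.
have [|x /andP[x1 _] hx] := @diag_poly_ivt theta 1 b b1.
  have h1 : theta * (1 ^+ 4 - 2) - (1 ^+ 3 - 1) <= 0 by lra.
  suff h2 : 0 <= theta * (b ^+ 4 - 2) - (b ^+ 3 - b) by rewrite mulr_le0_ge0.
  have tb : theta * b = 2 * theta + 1.
    by rewrite /b mulrDr divff ?gt_eqF // mulrC.
  have b3 : 1 <= b ^+ 3 by rewrite exprn_ege1.
  have : 0 <= theta * (b ^+ 3 - 1) by apply: mulr_ge0; lra.
  have -> : theta * (b ^+ 4 - 2) = (theta * b) * b ^+ 3 - 2 * theta by ring.
  rewrite tb; lra.
exists x => //; rewrite lt_neqAle x1 andbT; apply/negP => /eqP E.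
by move: hx; rewrite -E; lra.
Qed.

(* Counts the solutions with z_0 = 1, parametrized by v = cube root of z_1. They
   form a level set of v |-> (v^3 - v) / (v^4 - 2), which increases on (0, v0),
   decreases on (v0, 1), is negative on (1, 2^(1/4)) and decreases beyond. *)
Definition diag_count theta (N : nat) :=
  exists s : seq R, [/\ uniq s, size s = N &
    forall v, (v \in s) = (0 < v) && (theta * (v ^+ 4 - 2) == v ^+ 3 - v)].

(** One root [v1] lies beyond 1 for every [theta]. A root in (0, 1) forces [theta <= c], with
    equality only at [v0]. Below [c] the sign is positive at [v0] and negative at 0 and 1, giving a
    root on each side of [v0]; monotonicity of a divided difference excludes a third. *)
Lemma diag_counts (v0 c theta : R) : 0 < v0 < 1 -> 0 < theta ->
  v0 ^+ 6 - 3 * v0 ^+ 4 + 6 * v0 ^+ 2 - 2 = 0 ->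
  c * (v0 ^+ 4 - 2) = v0 ^+ 3 - v0 ->
  [/\ c < theta -> diag_count theta 1,
      theta = c -> diag_count theta 2
    & theta < c -> diag_count theta 3].
Proof.
move=> hv0 t0 crit hc.
have [v1 v1_gt hv1] := diag_outer_exists t0.
have v04 : v0 ^+ 4 < 1 by case/andP: hv0 => ? ?; rewrite exprn_ilt1 // ltW.
have inner b : 0 < b < 1 -> theta * (b ^+ 4 - 2) = b ^+ 3 - b ->
    theta <= c ?= iff (b == v0).
  move=> hb Eb.
  have b4 : b ^+ 4 < 1 by case/andP: hb => ? ?; rewrite exprn_ilt1 // ltW.
  have := diag_cross v0 b; rewrite crit mulr0 subr0 -Eb -hc => E.
  have {}E : (c - theta) * ((2 - b ^+ 4) * (2 - v0 ^+ 4)) =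
      (b - v0) ^+ 2 * diag_gap v0 b.
    by lra.
  have g0 := diag_gap_gt0 hv0 hb.
  have p0 : 0 < (2 - b ^+ 4) * (2 - v0 ^+ 4) by apply: mulr_gt0; lra.
  split.
    by rewrite -subr_ge0 -(pmulr_lge0 _ p0) E mulr_ge0 ?sqr_ge0 // ltW.
  rewrite eq_sym -subr_eq0 -(mulIr_eq0 _ (mulIf (lt0r_neq0 p0))) E mulf_eq0.
  by rewrite (gt_eqF g0) orbF sqrf_eq0 subr_eq0.
have outer b : 1 <= b -> theta * (b ^+ 4 - 2) = b ^+ 3 - b -> b = v1.
  by move=> b1 Eb; apply: (diag_outer_unique t0 b1 (ltW v1_gt) Eb hv1).
have v1_gt0 : 0 < v1 by lra.
case/andP: (hv0) => v0_gt0 v0_lt1.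
split.
- move=> ct; exists [:: v1]; split => // v; rewrite inE.
  apply/eqP/andP => [->|[v_gt0 /eqP Ev]]; first by rewrite v1_gt0 hv1.
  have [v_ge1|v_lt1] := leP 1 v; first exact: outer.
  have [|h _] := inner v _ Ev; first by rewrite v_gt0.
  by move: ct; rewrite ltNge h.
- move=> tc; exists [:: v1; v0]; split => //.
    by rewrite /= inE andbT gt_eqF // (lt_trans v0_lt1).
  move=> v; rewrite !inE; apply/orP/andP.
    by case=> /eqP ->; rewrite ?v1_gt0 ?v0_gt0 ?hv1 // tc hc.
  case=> v_gt0 /eqP Ev.
  have [v_ge1|v_lt1] := leP 1 v; first by left; apply/eqP; exact: outer.
  have [|_] := inner v _ Ev; first by rewrite v_gt0.
  by rewrite tc eqxx => <-; right.
move=> tc.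
have hm : 0 < theta * (v0 ^+ 4 - 2) - (v0 ^+ 3 - v0).
  have -> : theta * (v0 ^+ 4 - 2) - (v0 ^+ 3 - v0) =
      (c - theta) * (2 - v0 ^+ 4).
    by rewrite -hc; ring.
  by apply: mulr_gt0; lra.
have [|a /andP[a0 av] Ea] := @diag_poly_ivt theta 0 v0 (ltW v0_gt0).
  rewrite mulr_le0_ge0 ?(ltW hm) //; rewrite !expr0n /=; lra.
have [|b /andP[bv b1] Eb] := @diag_poly_ivt theta v0 1 (ltW v0_lt1).
  rewrite mulr_ge0_le0 ?(ltW hm) //; rewrite !expr1n; lra.
have a_gt0 : 0 < a.
  rewrite lt_neqAle a0 andbT; apply/negP => /eqP E.
  by move: Ea; rewrite -E !expr0n /=; lra.
have b_lt1 : b < 1.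
  rewrite lt_neqAle b1 andbT; apply/negP => /eqP E.
  by move: Eb; rewrite E !expr1n /=; lra.
have nv0 x : theta * (x ^+ 4 - 2) = x ^+ 3 - x -> x != v0.
  by move=> Ex; apply/negP => /eqP E; move: hm; rewrite -E Ex subrr ltxx.
have {}av : a < v0 by rewrite lt_neqAle av nv0.
have {}bv : v0 < b by rewrite lt_neqAle bv eq_sym nv0.
exists [:: v1; b; a]; split => //.
  rewrite /= !inE negb_or; apply/andP; split; last by rewrite andbT; lra.
  by apply/andP; split; lra.
move=> v; rewrite !inE; apply/idP/andP.
  by case/or3P => /eqP ->; split; rewrite ?hv1 ?Eb ?Ea //; lra.
case=> v_gt0 /eqP Ev.
have [v_ge1|v_lt1] := leP 1 v; first by rewrite (outer v) // eqxx.
have [|vb] := eqVneq v b; first by rewrite orbT.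
have [|va] := eqVneq v a; first by rewrite !orbT.
exfalso.
(* [B x y] is the cross product of diag_cross divided by y - x. It vanishes at
   (a, b) and at (a, v), but is strictly decreasing in its second argument. *)
pose B x y := - (x * y) ^+ 3 + (x * y - 2) * (x ^+ 2 + x * y + y ^+ 2) + 2.
have B0 x y : theta * (x ^+ 4 - 2) = x ^+ 3 - x ->
    theta * (y ^+ 4 - 2) = y ^+ 3 - y -> x != y -> B x y = 0.
  move=> Ex Ey xy; have : (y - x) * B x y = 0.
    have -> : (y - x) * B x y =
      (y ^+ 3 - y) * (x ^+ 4 - 2) - (x ^+ 3 - x) * (y ^+ 4 - 2)
          by rewrite /B; ring.
    by rewrite -Ex -Ey; ring.
  by move/eqP; rewrite mulf_eq0 subr_eq0 eq_sym (negPf xy) => /eqP.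
have := B0 _ _ Ea Eb; rewrite (lt_eqF (lt_trans av bv)) => /(_ isT) Bab.
have := B0 _ _ Ea Ev; rewrite eq_sym va => /(_ isT) Bav.
have : (v - b) * (a ^+ 3 * (b ^+ 2 + b * v + v ^+ 2) + 2 * a + 2 * (b + v) - a
    ^+ 3 -
    a ^+ 2 * (b + v) - a * (b ^+ 2 + b * v + v ^+ 2)) = 0.
  by rewrite -[RHS](subrr 0) -{1}Bab -Bav /B; ring.
move/eqP; rewrite mulf_eq0 subr_eq0 (negPf vb) /= => /eqP.
have a1 : a < 1 by lra.
have b0 : 0 < b by lra.
have : 0 < a ^+ 3 * (b ^+ 2 + b * v + v ^+ 2).
  by rewrite mulr_gt0 ?exprn_gt0 // !addr_gt0 ?mulr_gt0 ?exprn_gt0.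
have av2 : 0 <= v * (1 - a * v).
  by apply: mulr_ge0; [lra | rewrite subr_ge0 mulr_ile1 ?ltW].
have ab2 : 0 <= b * (1 - a * b).
  by apply: mulr_ge0; [lra | rewrite subr_ge0 mulr_ile1 ?ltW].
have abv : 0 <= a * (1 - b * v).
  by apply: mulr_ge0; [lra | rewrite subr_ge0 mulr_ile1 ?ltW].
have a2 : 0 < 1 - a ^+ 2 by rewrite subr_gt0 exprn_ilt1.
have aa : 0 <= (a + b + v) * (1 - a ^+ 2) by apply: mulr_ge0; lra.
lra.
Qed.

End Diagonal.

(** * The closed form of the critical value [theta_c] *)

Section ThetaC.
Variable R : realType.

Lemma cbrt_silver_gt0 : 0 < cbrt_silver R.
Proof. by rewrite powR_gt0 // ltr_wpDr ?sqrtr_ge0. Qed.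

Lemma cbrt_silver_cube : cbrt_silver R ^+ 3 = 1 + Num.sqrt 2.
Proof.
rewrite -powR_mulrn ?ltW ?cbrt_silver_gt0 // -powRrM mulVf ?pnatr_eq0 //.
by rewrite powRr1 // addr_ge0 ?sqrtr_ge0.
Qed.

(* The critical point is v0 = sqrt w with w^3 - 3 w^2 + 6 w - 2 = 0; Cardano's
   formula gives w = 1 + c^-1 - c. *)
Lemma lt_of_exprn n (a b : R) : 0 <= a -> 0 <= b -> a ^+ n.+1 < b ^+ n.+1 ->
    a < b.
Proof. by move=> a0 b0; rewrite ltr_pXn2r. Qed.

(** Identifies [theta_c] with the value of (v^3 - v) / (v^4 - 2) at its critical point in (0, 1),
    and locates it numerically. *)
Lemma theta_c_critical : exists v0 : R, [/\ 0 < v0 < 1,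
  v0 ^+ 6 - 3 * v0 ^+ 4 + 6 * v0 ^+ 2 - 2 = 0,
  theta_c R * (v0 ^+ 4 - 2) = v0 ^+ 3 - v0 &
  `|theta_c R - 206 / 10 ^+ 3| < 5 / 10 ^+ 4].
Proof.
have c0 := cbrt_silver_gt0; have c3 := cbrt_silver_cube.
rewrite /theta_c; set c := cbrt_silver R in c0 c3 *.
have r0 : 0 <= Num.sqrt (2 : R) by exact: sqrtr_ge0.
have r2 : Num.sqrt (2 : R) ^+ 2 = 2 by rewrite sqr_sqrtr.
set r := Num.sqrt (2 : R) in c3 r0 r2 *.
have r_hi : r < 2 by apply: (@lt_of_exprn 1); rewrite ?r2; lra.
have c_hi : c < 3 / 2 by apply: (@lt_of_exprn 2); rewrite ?c3; lra.
have e0 : 0 < 1 + c - c ^+ 2 by nra.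
have ce0 : 0 < c * (1 + c - c ^+ 2) by exact: mulr_gt0.
have d0 : 0 < Num.sqrt (c * (1 + c - c ^+ 2)) by rewrite sqrtr_gt0.
have d2 : Num.sqrt (c * (1 + c - c ^+ 2)) ^+ 2 = c * (1 + c - c ^+ 2).
  by rewrite sqr_sqrtr // ltW.
set d := Num.sqrt (c * _) in d0 d2 *.
pose v := d / c; pose w := (1 + c - c ^+ 2) / c.
have cn0 : c != 0 by rewrite gt_eqF.
have vw : v ^+ 2 = w by rewrite /v /w expr_div_n d2; field.
have v0 : 0 < v by rewrite divr_gt0.
have w0 : 0 < w by rewrite divr_gt0.
have Kw : w ^+ 3 - 3 * w ^+ 2 + 6 * w - 2 = 0.
  have -> : w ^+ 3 - 3 * w ^+ 2 + 6 * w - 2 =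
    (1 - (c ^+ 3) ^+ 2 + 2 * c ^+ 3) / c ^+ 3 by rewrite /w; field.
  rewrite c3; have -> : 1 - (1 + r) ^+ 2 + 2 * (1 + r) = 2 - r ^+ 2 by ring.
  by rewrite r2 subrr mul0r.
(* The cubic has positive difference quotients, so comparing [w] with a rational amounts to
   evaluating the cubic there. *)
have w_cmp a : (w - a) * (w ^+ 2 + w * a + a ^+ 2 - 3 * (w + a) + 6)
    = - (a ^+ 3 - 3 * a ^+ 2 + 6 * a - 2).
  by rewrite -[RHS]add0r -Kw; ring.
have w_pos a : 0 < w ^+ 2 + w * a + a ^+ 2 - 3 * (w + a) + 6.
  have -> : w ^+ 2 + w * a + a ^+ 2 - 3 * (w + a) + 6 =
    (w + a / 2 - 3 / 2) ^+ 2 + 3 / 4 * (a - 1) ^+ 2 + 3 by field.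
  by have := sqr_ge0 (w + a / 2 - 3 / 2); have := sqr_ge0 (a - 1); lra.
have w_lo : 21 / 52 < w.
  by rewrite -subr_gt0 -(pmulr_lgt0 _ (w_pos (21 / 52))) w_cmp; lra.
have w_hi : w < 101 / 250.
  by rewrite -subr_lt0 -(pmulr_llt0 _ (w_pos (101 / 250))) w_cmp; lra.
have v_lo : 317 / 500 < v by apply: (@lt_of_exprn 1); rewrite ?vw; lra.
have v_hi : v < 159 / 250 by apply: (@lt_of_exprn 1); rewrite ?vw; lra.
have v4 : v ^+ 4 = w ^+ 2 by rewrite -vw -exprM.
(* With [c ^+ 3 = 1 + r] the denominator of [theta_c] becomes a multiple of v^4 - 2. *)
have den : c ^+ 4 - 3 * c ^+ 2 + 2 * c - 2 * r - 1 = c ^+ 2 * (w ^+ 2 - 2).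
  have -> : r = c ^+ 3 - 1 by rewrite c3; ring.
  by rewrite /w; field.
have q0 : w ^+ 2 - 2 < 0 by nra.
have -> : (1 - c ^+ 2) * d / (c ^+ 4 - 3 * c ^+ 2 + 2 * c - 2 * r - 1) =
    v * (w - 1) / (w ^+ 2 - 2).
  rewrite den; have -> : v * (w - 1) = (1 - c ^+ 2) * d / c ^+ 2.
    by rewrite /v /w; field.
  by field; rewrite (lt_eqF q0) cn0.
exists v; split.
- by rewrite v0; lra.
- by rewrite -Kw -vw; ring.
- rewrite v4 divfK ?(lt_eqF q0) // -vw; ring.
have n0 : 0 < 2 - w ^+ 2 by lra.
have -> : v * (w - 1) / (w ^+ 2 - 2) = v * (1 - w) / (2 - w ^+ 2).
  by field; rewrite (lt_eqF q0) (gt_eqF n0).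
(* 413/2000 and 411/2000 are the ends of the tolerance interval around 0.206. *)
have up : v * (1 - w) / (2 - w ^+ 2) < 413 / 2000.
  by rewrite ltr_pdivrMr //; nra.
have lo : 411 / 2000 < v * (1 - w) / (2 - w ^+ 2).
  by rewrite ltr_pdivlMr //; nra.
by rewrite ltr_norml; apply/andP; split; lra.
Qed.

End ThetaC.

(** * Solutions with z_0 <> 1 *)

Section OffDiagonal.
Variable R : realType.
Implicit Types P T theta : R.

Definition quartic T P : R :=
  T ^+ 2 * P ^+ 4 - T * P ^+ 3 + (1 - 3 * T) * P + 1.

Lemma quartic_ivt T a b : a <= b -> quartic T a * quartic T b <= 0 ->
  exists2 x, a <= x <= b & quartic T x = 0.
Proof.
pose p : {poly R} := T ^+ 2 *: 'X^4 - T *: 'X^3 + (1 - 3 * T) *: 'X + 1%:P.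
have pE x : p.[x] = quartic T x by rewrite /quartic !hornerE.
move=> ab; rewrite -!pE => /(poly_sign_change ab)[x xab].
by rewrite pE => E; exists x.
Qed.

(* [quartic T P / P ^+ 2] is strictly convex in P when T < 1/3. *)
Lemma quartic_two_roots T a b c : 0 < T -> 3 * T < 1 -> 0 < a -> 0 < b ->
  0 < c -> quartic T a = 0 -> quartic T b = 0 -> quartic T c = 0 ->
  a != b -> a != c -> b = c.
Proof.
move=> T0 T1 a0 b0 c0 Ea Eb Ec ab ac; apply/eqP/negPn/negP => bc.
have g0 x : 0 < x -> quartic T x = 0 ->
    T ^+ 2 * x ^+ 2 - T * x + (1 - 3 * T) * x^-1 + x^-1 ^+ 2 = 0.
  move=> x0 E; transitivity (quartic T x / x ^+ 2); last by rewrite E mul0r.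
  by rewrite /quartic; field; rewrite gt_eqF.
have := g0 _ c0 Ec; have := g0 _ b0 Eb; have := g0 _ a0 Ea => ga gb gc.
(* Second divided difference of the quartic over P^2: it would vanish at three roots, but its last
   factor is positive. *)
have dd x y z : x != 0 -> y != 0 -> z != 0 ->
  (y - z) * (T ^+ 2 * x ^+ 2 - T * x + (1 - 3 * T) * x^-1 + x^-1 ^+ 2) +
  (z - x) * (T ^+ 2 * y ^+ 2 - T * y + (1 - 3 * T) * y^-1 + y^-1 ^+ 2) +
  (x - y) * (T ^+ 2 * z ^+ 2 - T * z + (1 - 3 * T) * z^-1 + z^-1 ^+ 2) =
  - (x - y) * (y - z) * (z - x) * (T ^+ 2 + (1 - 3 * T) * (x^-1 * y^-1 * z^-1)
   + (x^-1 * y^-1 * z^-1) * (x^-1 + y^-1 + z^-1)).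
  by move=> x0 y0 z0; field; rewrite x0 y0 z0.
have := dd a b c (lt0r_neq0 a0) (lt0r_neq0 b0) (lt0r_neq0 c0).
rewrite ga gb gc !mulr0 !addr0 => /esym/eqP.
rewrite !mulf_eq0 oppr_eq0 !subr_eq0 (negPf ab) (negPf bc) eq_sym (negPf ac) /=.
have i : 0 < a^-1 /\ 0 < b^-1 /\ 0 < c^-1 by rewrite !invr_gt0.
case: i => i1 [i2 i3].
have i4 : 0 < a^-1 * b^-1 * c^-1 by rewrite !mulr_gt0.
have i5 : 0 < (1 - 3 * T) * (a^-1 * b^-1 * c^-1) by apply: mulr_gt0; lra.
have i6 : 0 < a^-1 * b^-1 * c^-1 * (a^-1 + b^-1 + c^-1)
    by rewrite mulr_gt0 ?addr_gt0.
by rewrite gt_eqF // !addr_gt0 ?exprn_gt0.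
Qed.

Definition off_count T (N : nat) :=
  exists s : seq R, [/\ uniq s, size s = N &
    forall P, (P \in s) = (3 <= P) && (quartic T P == 0)].

(** Being a square, the value at 3 has the sign needed for the intermediate value argument on
    [3, m], whatever [T] is. *)
Lemma quartic_at3 T : quartic T 3 = (9 * T - 2) ^+ 2.
Proof. by rewrite /quartic; ring. Qed.

(* Double root of the quartic: eliminating T from the quartic and its
   P-derivative leaves T = (3P + 4) / (P^3 + 9P) and the quintic below. *)
Lemma critical_T_exists : exists P0 T0 : R, [/\ 3 < P0 < 31 / 10,
    quartic T0 P0 = 0,
  4 * T0 ^+ 2 * P0 ^+ 3 - 3 * T0 * P0 ^+ 2 + (1 - 3 * T0) = 0 &
  47 / 203 < T0 < 129 / 557].
Proof.
pose p : {poly R} := 2 *: 'X^5 - 6 *: 'X^4 - 6 *: 'X^3 + 14 *: 'X^2 + 27%:P.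
have pE x : p.[x] = 2 * x ^+ 5 - 6 * x ^+ 4 - 6 * x ^+ 3 + 14 * x ^+ 2 + 27.
  by rewrite !hornerE.
(* A bracket of the root near 3.0895, narrow enough to give the stated bounds on T. *)
have [||P /andP[Pl Ph] EP] :=
    @poly_sign_change _ p (380 / 123) (207 / 67); try by rewrite ?pE; lra.
rewrite pE in EP.
have d0 : 0 < P ^+ 3 + 9 * P by rewrite addr_gt0 ?exprn_gt0 ?mulr_gt0 //; lra.
have Pn0 : P != 0 by apply/eqP; lra.
have dn0 : P ^+ 2 + 9 != 0 by rewrite gt_eqF // addr_gt0 ?exprn_gt0 //; lra.
have d0n := lt0r_neq0 d0.
exists P, ((3 * P + 4) / (P ^+ 3 + 9 * P)); split.
- by apply/andP; split; lra.
- have -> : quartic ((3 * P + 4) / (P ^+ 3 + 9 * P)) P =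
    - (2 * P ^+ 5 - 6 * P ^+ 4 - 6 * P ^+ 3 + 14 * P ^+ 2 + 27) / (P ^+ 2 + 9)
        ^+ 2.
    by rewrite /quartic; field; rewrite dn0 d0n.
  by rewrite EP oppr0 mul0r.
- have -> : 4 * ((3 * P + 4) / (P ^+ 3 + 9 * P)) ^+ 2 * P ^+ 3 -
     3 * ((3 * P + 4) / (P ^+ 3 + 9 * P)) * P ^+ 2 +
     (1 - 3 * ((3 * P + 4) / (P ^+ 3 + 9 * P))) =
    - 4 * (2 * P ^+ 5 - 6 * P ^+ 4 - 6 * P ^+ 3 + 14 * P ^+ 2 + 27) /
      (P * (P ^+ 2 + 9) ^+ 2).
    by field; rewrite ?d0n ?dn0 ?Pn0.
  by rewrite EP mulr0 mul0r.
have P3l : (380 / 123) ^+ 3 <= P ^+ 3 by apply: lerXn2r; rewrite ?nnegrE; lra.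
have P3h : P ^+ 3 <= (207 / 67) ^+ 3 by apply: lerXn2r; rewrite ?nnegrE; lra.
apply/andP; split; first by rewrite ltr_pdivlMr //; lra.
by rewrite ltr_pdivrMr //; lra.
Qed.

(** At the critical parameter the quartic is (P - P0)^2 times a quadratic that is positive for P >=
    3. Above it, a root is excluded by viewing the quartic as quadratic in T. Below it, the quartic
    is negative at some point beyond P0, with a root on each side. *)
Lemma off_counts : exists2 That : R, 47 / 203 < That < 129 / 557 &
  forall T, 0 < T ->
  [/\ That < T -> off_count T 0, T = That -> off_count T 1
    & T < That -> off_count T 2].
Proof.
have [P0 [T0 [/andP[P03 P03h] E0 D0 /andP[Tl Th]]]] := critical_T_exists.
exists T0; first by rewrite Tl.
have fact P : 3 <= P -> 0 <= quartic T0 P ?= iff (P == P0).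
  move=> P3; pose b := 2 * T0 ^+ 2 * P0 - T0.
  pose c := 3 * T0 ^+ 2 * P0 ^+ 2 - 2 * T0 * P0.
  have fE : quartic T0 P = (P - P0) ^+ 2 * (T0 ^+ 2 * P ^+ 2 + b * P + c)
     + quartic T0 P0 + (P - P0) * (4 * T0 ^+ 2 * P0 ^+ 3 - 3 * T0 * P0 ^+ 2 +
         (1 - 3 * T0)).
    by rewrite /b /c /quartic; ring.
  rewrite E0 D0 mulr0 !addr0 in fE.
  (* Comparing the coefficients of degree 0 and 1 with those of the quartic, 1 and [1 - 3 * T0],
     shows that [c] and [b] are positive. *)
  have c1 : c * P0 ^+ 2 = 1.
    have <- : quartic T0 P0 + (0 - P0) * (4 * T0 ^+ 2 * P0 ^+ 3 - 3 * T0 * P0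
        ^+ 2 + (1 - 3 * T0))
      + c * P0 ^+ 2 = 1 by rewrite /c /quartic; ring.
    by rewrite E0 D0 mulr0 !add0r.
  have p2 : 0 < P0 ^+ 2 by rewrite exprn_gt0 //; lra.
  have c0 : 0 < c by rewrite -(pmulr_lgt0 _ p2) c1.
  have b1 : b * P0 ^+ 2 = 2 * P0 * c + (1 - 3 * T0).
    apply/eqP; rewrite -subr_eq0; apply/eqP; rewrite -[RHS]oppr0 -D0 /b /c;
        ring.
  have b0 : 0 < b.
    have h : 0 < P0 * c by apply: mulr_gt0; lra.
    rewrite -(pmulr_lgt0 _ p2).
    by rewrite b1; lra.
  have q0 : 0 < T0 ^+ 2 * P ^+ 2 + b * P + c.
    have [T00 P00] : 0 < T0 /\ 0 < P by split; lra.
    apply: addr_gt0 => //; apply: addr_gt0; last exact: mulr_gt0.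
    by rewrite mulr_gt0 ?exprn_gt0.
  rewrite fE; split; first by rewrite mulr_ge0 ?sqr_ge0 // ltW.
  by rewrite eq_sym mulf_eq0 (gt_eqF q0) orbF sqrf_eq0 subr_eq0.
move=> T Tp; split.
- move=> TT; exists [::]; split => // P; rewrite in_nil; apply/esym/negbTE/negP.
  move=> /andP[P3 /eqP E].
  have [h _] := fact P P3.
  have P4 : 0 < P ^+ 4 by apply: exprn_gt0; lra.
  (* The roots T, T' of [quartic _ P] have product
     (P + 1) / P ^+ 4 <= 4 / 81. *)
  have e : T * quartic T0 P = (T0 - T) * (T * T0 * P ^+ 4 - (P + 1)).
    have -> : T * quartic T0 P = (T0 - T) * (T * T0 * P ^+ 4 - (P + 1)) + T0 *
        quartic T P.
      by rewrite /quartic; ring.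
    by rewrite E mulr0 addr0.
  have h1 : T * T0 * P ^+ 4 <= P + 1.
    have : 0 <= T * quartic T0 P by rewrite mulr_ge0 // ltW.
    by rewrite e nmulr_rge0 ?subr_lt0 // subr_le0.
  have h2 : T0 * T0 * P ^+ 4 <= T * T0 * P ^+ 4.
    by rewrite !ler_wpM2r ?(ltW P4) ?(ltW TT) //; lra.
  have h3 : 4 * P ^+ 4 >= 81 * (P + 1).
    have -> : P ^+ 4 = P * P ^+ 3 by ring.
    have p3 : 27 <= P ^+ 3.
      have -> : 27 = 3 ^+ 3 :> R by ring.
      by rewrite lerXn2r ?nnegrE //; lra.
    have : 0 <= P * (P ^+ 3 - 27) by rewrite mulr_ge0 //; lra.
    lra.
  have h4 : (T0 * T0 - 4 / 81) * P ^+ 4 > 0 by rewrite mulr_gt0 //; nra.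
  lra.
- move=> ->; exists [:: P0]; split => // P; rewrite inE.
  apply/eqP/andP => [->|[P3]]; first by rewrite E0 (ltW P03).
  by rewrite eq_sym (fact P P3) => /eqP.
move=> TT.
(* Along Q = T P the rescaled quartic T^2 quartic T (Q/T) increases with T. *)
pose Q := T0 * P0; pose m := Q / T.
have mT : m * T = Q by rewrite divfK // gt_eqF.
have Q1 : 6 / 10 < Q by rewrite /Q; nra.
have m3 : P0 < m by rewrite ltr_pdivlMr // mulrC /Q ltr_pM2r //; lra.
have m_neg : quartic T m < 0.
  have T2 : 0 < T ^+ 2 by rewrite exprn_gt0.
  rewrite -(pmulr_rlt0 _ T2).
  have -> : T ^+ 2 * quartic T m = (m * T) ^+ 4 - (m * T) ^+ 3
     + (1 - 3 * T) * T * (m * T) + T ^+ 2 by rewrite /quartic; ring.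
  rewrite mT.
  have e : Q ^+ 4 - Q ^+ 3 + (1 - 3 * T0) * T0 * Q + T0 ^+ 2 = 0.
    have <- : T0 ^+ 2 * quartic T0 P0 = 0 by rewrite E0 mulr0.
    by rewrite /Q /quartic; ring.
  have : 0 < (T0 - T) * (Q * (1 - 3 * (T0 + T)) + (T0 + T)).
    rewrite mulr_gt0 ?subr_gt0 //.
    have hQ : Q <= 129 / 557 * (31 / 10) by rewrite ler_pM; lra.
    have : 0 <= (258 / 557 - (T0 + T)) * (3 * Q - 1) by apply: mulr_ge0; lra.
    lra.
  lra.
have q3 : 0 <= quartic T 3 by rewrite quartic_at3 sqr_ge0.
have [|a /andP[a3 am] Ea] := @quartic_ivt T 3 m (ltW (lt_trans P03 m3)).
  by rewrite mulr_ge0_le0 // ltW.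
(* At X = m + 1/T one has T X >= 1, so T^2 X^4 dominates T X^3 and the quartic is nonnegative. *)
have mM : m <= m + T^-1 by rewrite lerDl invr_ge0 ltW.
have [|b /andP[bm _] Eb] := @quartic_ivt T m (m + T^-1) mM.
  rewrite mulr_le0_ge0 ?(ltW m_neg) //.
  have TX : 1 <= T * (m + T^-1).
    by rewrite mulrDr divff ?gt_eqF // lerDr mulr_ge0 ?(ltW Tp) //; lra.
  have X0 : 0 < m + T^-1 by rewrite addr_gt0 ?invr_gt0 //; lra.
  set X := m + _ in TX X0 *.
  have -> : quartic T X = T * X * X ^+ 2 * (T * X - 1) + (1 - 3 * T) * X + 1.
    by rewrite /quartic; ring.
  rewrite !addr_ge0 // mulr_ge0 ?mulr_ge0 ?exprn_ge0 ?(ltW X0) ?(ltW Tp) //;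
      lra.
have am' : a < m.
  rewrite lt_neqAle am andbT; apply/negP => /eqP E.
  by move: m_neg; rewrite -E Ea ltxx.
have bm' : m < b.
  rewrite lt_neqAle bm andbT; apply/negP => /eqP E.
  by move: m_neg; rewrite E Eb ltxx.
have ab : a != b by rewrite lt_eqF // (lt_trans am').
exists [:: a; b]; split => //; first by rewrite /= inE ab.
move=> P; rewrite !inE; apply/orP/andP.
  by case=> /eqP ->; rewrite ?Ea ?Eb eqxx; split => //; lra.
case=> P3 /eqP EP; have [->|Pa] := eqVneq P a; first by left.
right; apply/eqP/esym; apply: (quartic_two_roots Tp _ _ _ _ Ea Eb EP ab); lra.
Qed.

End OffDiagonal.

(** * Counting *)

Section System.
Variable R : realType.
Implicit Types (theta u v w p P T : R).

Definition TI_solution theta (z : R * R) : Prop :=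
  [/\ 0 < z.1, 0 < z.2,
      z.1 = ((z.1 + theta * z.2) / (theta * z.2 + 1)) ^+ 3 &
      z.2 = ((theta * z.1 + z.2 + theta) / (theta * z.2 + 1)) ^+ 3].

Definition cbrt_solution theta (q : R * R) : Prop :=
  [/\ 0 < q.1, 0 < q.2,
      q.1 * (theta * q.2 ^+ 3 + 1) = q.1 ^+ 3 + theta * q.2 ^+ 3 &
      q.2 * (theta * q.2 ^+ 3 + 1) = theta * q.1 ^+ 3 + q.2 ^+ 3 + theta].

Lemma expr3_inj (x y : R) : 0 < x -> 0 < y -> x ^+ 3 = y ^+ 3 -> x = y.
Proof. by move=> x0 y0 E; apply: (@pexpIrn _ 3) => //; rewrite nnegrE ltW. Qed.

Definition cubes (q : R * R) : R * R := (q.1 ^+ 3, q.2 ^+ 3).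

Lemma TI_solution_cbrt theta z : 0 < theta ->
  TI_solution theta z <-> exists2 q, cbrt_solution theta q & z = cubes q.
Proof.
move=> t0; split.
  case: z => a b [/= a0 b0 Ea Eb].
  have d0 : 0 < theta * b + 1 by rewrite addr_gt0 ?mulr_gt0.
  have dn0 := lt0r_neq0 d0.
  exists ((a + theta * b) / (theta * b + 1),
    (theta * a + b + theta) / (theta * b + 1)); last
        by rewrite /cubes /= -Ea -Eb.
  by split=> /=; rewrite -?Ea -?Eb ?divfK // divr_gt0 // !addr_gt0 ?mulr_gt0.
case=> -[u v] [/= u0 v0 Eu Ev] ->.
have d0 : 0 < theta * v ^+ 3 + 1 by rewrite addr_gt0 ?mulr_gt0 ?exprn_gt0.
by split; rewrite /= ?exprn_gt0 // -?Eu -?Ev mulfK ?gt_eqF.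
Qed.

(** The spin symmetry exchanging 0 and 2, renormalized to z_2 = 1 and written in cube roots. It
    replaces w by 1/w and keeps P. *)
Definition flip (q : R * R) : R * R := (q.1^-1, q.2 / q.1).

Lemma flipK q : 0 < q.1 -> flip (flip q) = q.
Proof.
by case: q => u v /= u0; rewrite /flip /= invrK -mulrA mulVf ?mulr1 // gt_eqF
    //.
Qed.

Lemma cbrt_solution_flip theta q : cbrt_solution theta q ->
  cbrt_solution theta (flip q).
Proof.
case: q => u v [/= u0 v0 Eu Ev]; have un0 := lt0r_neq0 u0.
split; rewrite /= ?invr_gt0 ?divr_gt0 //.
  have -> : u^-1 * (theta * (v / u) ^+ 3 + 1) =
     (u ^+ 3 + theta * v ^+ 3) / u ^+ 4 by field.
  by rewrite -Eu; field.
have -> : v / u * (theta * (v / u) ^+ 3 + 1) =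
    (v * (theta * v ^+ 3 + 1) + v * (u ^+ 3 - 1)) / u ^+ 4 by field.
have h : u * (v * (theta * v ^+ 3 + 1)) = v * (u ^+ 3 + theta * v ^+ 3).
  by rewrite -Eu; ring.
have -> : v * (theta * v ^+ 3 + 1) + v * (u ^+ 3 - 1) =
   v * (u ^+ 3 + theta * v ^+ 3) by ring.
by rewrite -h Ev; field.
Qed.

Lemma cbrt_solution_diag theta v : 0 < theta -> 0 < v ->
  cbrt_solution theta (1, v) <-> theta * (v ^+ 4 - 2) = v ^+ 3 - v.
Proof.
move=> t0 v0; split => [[/= _ _ _ E]|E].
  by move: E; rewrite expr1n => E; lra.
by split => //=; rewrite expr1n; lra.
Qed.

(* In the coordinates u = w^2, v = p w the first equation says that
   theta p^3 = w + w^-1, and the second one becomes the quartic. *)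
Lemma cbrt_solution_quartic theta w p : 0 < theta -> 0 < w -> 0 < p -> w != 1 ->
  cbrt_solution theta (w ^+ 2, p * w) <->
  theta * p ^+ 3 * w = w ^+ 2 + 1 /\ quartic (theta ^+ 2) (p ^+ 2) = 0.
Proof.
move=> t0 w0 p0 w1.
have wn0 := lt0r_neq0 w0; have pn0 := lt0r_neq0 p0.
have key : theta * p ^+ 3 * w = w ^+ 2 + 1 ->
    (p * w * (theta * (p * w) ^+ 3 + 1) = theta * w ^+ 2 ^+ 3 + (p * w) ^+ 3 +
        theta)
    <-> quartic (theta ^+ 2) (p ^+ 2) = 0.
  move=> E.
  have tE : theta = (w ^+ 2 + 1) / (w * p ^+ 3).
    by rewrite -E; field; rewrite ?wn0 ?pn0.
  have h : theta * w ^+ 2 ^+ 3 + (p * w) ^+ 3 + theta -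
      p * w * (theta * (p * w) ^+ 3 + 1) =
      w ^+ 3 * p * quartic (theta ^+ 2) (p ^+ 2).
    by rewrite /quartic tE; field; rewrite ?wn0 ?pn0.
  split => [e|e].
    move: h; rewrite e subrr => /esym/eqP; rewrite mulf_eq0 => /orP[|/eqP //].
    by rewrite mulf_eq0 (negPf pn0) expf_eq0 (negPf wn0).
  by apply/esym/eqP; rewrite -subr_eq0 h e mulr0.
split.
  case=> /= _ _ E1 E2.
  have E : theta * p ^+ 3 * w = w ^+ 2 + 1.
    have : w ^+ 2 * (w - 1) * (w + 1) * (theta * p ^+ 3 * w - (w ^+ 2 + 1)) = 0.
      by move/eqP: E1; rewrite -subr_eq0 => /eqP <-; ring.
    move/eqP; rewrite !mulf_eq0 (negPf wn0) subr_eq0 (negPf w1) /=.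
    by rewrite gt_eqF ?addr_gt0 //= subr_eq0 => /eqP.
  by split => //; apply/key.
case=> E F; split; rewrite /= ?mulr_gt0 ?exprn_gt0 //; last exact/key.
have -> : theta * (p * w) ^+ 3 = theta * p ^+ 3 * w * w ^+ 2 by ring.
by rewrite E; ring.
Qed.

(** By [E4], P >= 3 is incompatible with S <= 4, since the left side would be nonpositive.
    Conversely S > 4 gives P^2 >= S + 1 > 5, and the discriminant (P - 3)(P^3 - P^2 - P - 3) of the
    quadratic in S is then nonnegative only for P >= 3. *)
Lemma quartic_ge3 T P : 0 < T -> 0 < P -> quartic T P = 0 ->
  (3 <= P) = (4 < T * P ^+ 3).
Proof.
move=> T0 P0 E; set S := T * P ^+ 3.
have ES : S ^+ 2 - (P ^+ 2 + 3) * S + P ^+ 3 + P ^+ 2 = 0.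
  have -> : S ^+ 2 - (P ^+ 2 + 3) * S + P ^+ 3 + P ^+ 2 = P ^+ 2 * quartic T P.
    by rewrite /S /quartic; ring.
  by rewrite E mulr0.
have E4 : (4 - S) * (1 + S - P ^+ 2) = (P + 1) * (P - 2) ^+ 2.
  by rewrite -[RHS](subr0) -ES; ring.
have r0 : 0 <= (P + 1) * (P - 2) ^+ 2 by rewrite mulr_ge0 ?sqr_ge0 //; lra.
apply/idP/idP => [P3|S4].
  rewrite ltNge; apply/negP => S4.
  have r1 : 0 < (P + 1) * (P - 2) ^+ 2.
    by apply: mulr_gt0; [lra | apply: exprn_gt0; lra].
  have P2 : 9 <= P ^+ 2 by rewrite (_ : 9 = 3 ^+ 2) ?lerXn2r ?nnegrE //;
      [lra|ring].
  have : (4 - S) * (1 + S - P ^+ 2) <= 0 by apply: mulr_ge0_le0; lra.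
  lra.
have P2 : S + 1 <= P ^+ 2 by move: r0; rewrite -E4 nmulr_rge0; lra.
(* A rational lower bound for sqrt 5, above which P^3 - P^2 - P - 3 is positive. *)
have P5 : 11 / 5 < P by nra.
rewrite leNgt; apply/negP => P3.
have : 0 <= (P - 3) * (P ^+ 3 - P ^+ 2 - P - 3).
  have -> : (P - 3) * (P ^+ 3 - P ^+ 2 - P - 3) = (2 * S - (P ^+ 2 + 3)) ^+ 2.
    by rewrite -[LHS]addr0 -[X in _ + X](mulr0 4) -ES; ring.
  exact: sqr_ge0.
have : 0 < P ^+ 3 - P ^+ 2 - P - 3 by nra.
nra.
Qed.

Lemma add_inv_inj (w w' : R) : 1 < w -> 1 < w' -> w + w^-1 = w' + w'^-1 ->
    w = w'.
Proof.
move=> w1 w1' E; have [n n'] : w != 0 /\ w' != 0 by rewrite !gt_eqF //; lra.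
have : (w - w') * (w * w' - 1) = 0.
  have -> : (w - w') * (w * w' - 1) = w * w' * ((w + w^-1) - (w' + w'^-1)).
    by field; rewrite ?n ?n'.
  by rewrite E subrr mulr0.
move/eqP; rewrite mulf_eq0 subr_eq0 => /orP[/eqP //|].
by rewrite gt_eqF // subr_gt0 -[1]mulr1 ltr_pM //; lra.
Qed.

Lemma add_inv_exists (s : R) : 2 < s -> exists2 w, 1 < w & w + w^-1 = s.
Proof.
move=> s2; pose d := Num.sqrt (s ^+ 2 - 4).
have h : 0 <= s ^+ 2 - 4 by nra.
have d2 : d ^+ 2 = s ^+ 2 - 4 by rewrite sqr_sqrtr.
have d0 : 0 <= d by exact: sqrtr_ge0.
have w1 : 1 < (s + d) / 2 by lra.
exists ((s + d) / 2) => //.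
have n : s + d != 0 by rewrite gt_eqF //; lra.
apply: (mulfI n); rewrite mulrDr.
have -> : (s + d) * ((s + d) / 2)^-1 = 2 by field.
have -> : (s + d) * ((s + d) / 2) = (s ^+ 2 + 2 * s * d + d ^+ 2) / 2 by field.
by rewrite d2; field.
Qed.

(** Takes the root w > 1 of w + 1/w = theta p^3; the root 1/w gives the flipped solution. The
    default 1 is not reached at roots P >= 3 of the quartic. *)
Definition off_solution theta P : R * R :=
  let w := xget 1 [set w | 1 < w /\ w + w^-1 = theta * Num.sqrt P ^+ 3]%classic
      in
  (w ^+ 2, Num.sqrt P * w).

Lemma off_solutionP theta P : 0 < theta -> 3 <= P ->
  quartic (theta ^+ 2) P = 0 ->
  [/\ cbrt_solution theta (off_solution theta P), 1 < (off_solution theta P).1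
    & (off_solution theta P).2 ^+ 2 / (off_solution theta P).1 = P].
Proof.
move=> t0 P3 E; have P0 : 0 < P by lra.
have p0 : 0 < Num.sqrt P by rewrite sqrtr_gt0.
have p2 : Num.sqrt P ^+ 2 = P by rewrite sqr_sqrtr // ltW.
have T0 : 0 < theta ^+ 2 by rewrite exprn_gt0.
have s2 : 2 < theta * Num.sqrt P ^+ 3.
  apply: (@lt_of_exprn _ 1); rewrite ?mulr_ge0 ?exprn_ge0 ?(ltW t0) ?(ltW p0)
      //.
  have -> : (theta * Num.sqrt P ^+ 3) ^+ 2 = theta ^+ 2 * (Num.sqrt P ^+ 2) ^+
      3 by ring.
  by rewrite p2; move: P3; rewrite (quartic_ge3 T0 P0 E); lra.
rewrite /off_solution.
case: xgetP => [w _ [w1 Ew]|no]; last first.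
  by have [w w1 Ew] := add_inv_exists s2; case: (no w).
have w0 : 0 < w := lt_trans ltr01 w1.
split=> /=.
- apply/cbrt_solution_quartic => //; first by rewrite gt_eqF.
  rewrite p2 E -Ew; split => //; rewrite mulrDl mulVf ?gt_eqF //.
- by rewrite exprn_egt1.
- by rewrite exprMn mulfK ?p2 // gt_eqF // exprn_gt0.
Qed.

(** With w = sqrt u and P = v^2 / u, one has T P^3 = (w + 1/w)^2 > 4 because w <> 1, which is the
    condition P >= 3. *)
Lemma off_solution_complete theta q : 0 < theta -> cbrt_solution theta q ->
  1 < q.1 -> exists P, [/\ 3 <= P, quartic (theta ^+ 2) P = 0
    & q = off_solution theta P].
Proof.
case: q => u v /= t0 Q u1.
have [u0 v0] : 0 < u /\ 0 < v by case: Q.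
pose w := Num.sqrt u; have w0 : 0 < w by rewrite sqrtr_gt0.
have wu : w ^+ 2 = u by rewrite sqr_sqrtr // ltW.
have w1 : 1 < w by apply: (@lt_of_exprn _ 1); rewrite ?wu ?expr1n // ltW.
pose p := v / w; have p0 : 0 < p by rewrite divr_gt0.
have pw : p * w = v by rewrite divfK // gt_eqF.
have w1' : w != 1 by rewrite gt_eqF.
move: (Q); rewrite -wu -pw => /(cbrt_solution_quartic t0 w0 p0 w1')[Ew E].
have P0 : 0 < p ^+ 2 by rewrite exprn_gt0.
have T0 : 0 < theta ^+ 2 by rewrite exprn_gt0.
have {}Ew : w + w^-1 = theta * p ^+ 3.
  by rewrite -[RHS](mulfK (lt0r_neq0 w0)) Ew; field; rewrite gt_eqF.
have P3 : 3 <= p ^+ 2.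
  rewrite (quartic_ge3 T0 P0 E).
  have -> : theta ^+ 2 * p ^+ 2 ^+ 3 = (theta * p ^+ 3) ^+ 2 by ring.
  rewrite -Ew.
  have -> : (w + w^-1) ^+ 2 = (w - w^-1) ^+ 2 + 4 by field; rewrite gt_eqF.
  rewrite ltrDr exprn_even_gt0 //= subr_eq0; apply/eqP => h.
  have := mulfV (lt0r_neq0 w0); rewrite -h => h'.
  have : 1 < w * w by rewrite -[1]mulr1 ltr_pM // ltW.
  by rewrite h' ltxx.
exists (p ^+ 2); split => //.
have sp : Num.sqrt (p ^+ 2) = p by rewrite sqrtr_sqr gtr0_norm.
rewrite /off_solution sp; case: xgetP => [w' _ [w1'' Ew']|/(_ w)]; last by case.
by rewrite (add_inv_inj w1'' w1) // Ew' Ew.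
Qed.

Definition TI_count theta (N : nat) := exists s : seq (R * R),
  [/\ uniq s, size s = N & forall z, (z \in s) <-> TI_solution theta z].

(** The solutions with u = 1, u > 1 and u < 1 are disjoint, and [flip] exchanges the last two kinds.
    Those with u > 1 correspond to the roots P, recovered as v^2 / u. *)
Lemma TI_countE theta d m : 0 < theta ->
  diag_count theta d -> off_count (theta ^+ 2) m -> TI_count theta (d + m.*2).
Proof.
move=> t0 [ds [uds <- dsP]] [ps [ups <- psP]].
have psE P : P \in ps -> 3 <= P /\ quartic (theta ^+ 2) P = 0.
  by rewrite psP => /andP[? /eqP].
pose g := off_solution theta.
have gP P : P \in ps -> [/\ cbrt_solution theta (g P), 1 < (g P).1
    & (g P).2 ^+ 2 / (g P).1 = P].
  by case/psE => P3 E; exact: off_solutionP.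
pose qs := [seq (1, v) | v <- ds] ++ map g ps ++ map (flip \o g) ps.
have qsP q : q \in qs <-> cbrt_solution theta q.
  rewrite !mem_cat; split.
    case/or3P => /mapP[x xs ->].
    - by move: xs; rewrite dsP => /andP[x0 /eqP /(cbrt_solution_diag t0 x0)].
    - by have [] := gP x xs.
    - by apply: cbrt_solution_flip; have [] := gP x xs.
  have big q' : cbrt_solution theta q' -> 1 < q'.1 -> exists2 P,
      P \in ps & q' = g P.
    move=> Q1 Q2; have [P [P3 E ->]] := off_solution_complete t0 Q1 Q2.
    by exists P => //; rewrite psP P3 E eqxx.
  move=> Q; have [Q1 Q2 _ _] := Q.
  have [u1|u1|u1] := ltgtP q.1 1.
  - have [||P Pps E] := big (flip q); first exact: cbrt_solution_flip.
      by rewrite /= invf_gt1.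
    by rewrite [X in [|| _, _ | X]]( _ : _ = true) ?orbT //; apply/mapP;
        exists P;
       rewrite //= -E flipK.
  - by have [P Pps ->] := big q Q u1; rewrite map_f ?orbT.
  - move: Q Q2; rewrite (surjective_pairing q) u1 => /= Q v0.
    by rewrite map_f // dsP v0; apply/eqP/(cbrt_solution_diag t0 v0).
have g1 P : P \in ps -> 1 < (g P).1 by case/gP.
have f1 P : P \in ps -> (flip (g P)).1 < 1.
  by move=> /g1 h; rewrite /= invf_lt1 //; apply: lt_trans h.
have uqs : uniq qs.
  rewrite !cat_uniq map_inj_uniq ?uds => [/=|x y []//].
  have ug : {in ps &, injective g}.
    by move=> x y /gP[_ _ {2}<-] /gP[_ _ {2}<-] ->.
  rewrite !map_inj_in_uniq ?ups //=; last first.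
    move=> x y xs ys /= E; apply: ug => //.
    by rewrite -[g x]flipK -1?[g y]flipK ?E //; apply: lt_trans ltr01 (g1 _ _).
  rewrite andbT; apply/andP; split; apply/hasPn => q.
    rewrite mem_cat => /orP[] /mapP[P Pps ->]; apply/mapP =>
        -[v _ /(congr1 fst) E].
      by have := g1 _ Pps; rewrite E ltxx.
    by have := f1 _ Pps; rewrite (E : (flip (g P)).1 = 1) ltxx.
  case/mapP => P Pps ->; apply/mapP => -[P' Pps' E].
  have := g1 _ Pps'; rewrite -E => h.
  by have := lt_trans h (f1 _ Pps); rewrite ltxx.
exists (map cubes qs); split.
- rewrite map_inj_in_uniq // => -[u v] [u' v'] /qsP[/= ? ? _ _] /qsP[/= ? ? _
    _].
  by case=> /expr3_inj -> // /expr3_inj ->.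
- by rewrite size_map !size_cat !size_map addnn.
- move=> z; split => [/mapP[q /qsP Q ->]|/(TI_solution_cbrt _ t0)[q /qsP Q ->]].
    by apply/TI_solution_cbrt => //; exists q.
  exact: map_f.
Qed.

Lemma TI_counts : exists theta_hat : R,
  `|theta_hat - 4812 / 10 ^+ 4| < 5 / 10 ^+ 5 /\
  forall theta : R, 0 < theta ->
  [/\ theta_hat < theta -> TI_count theta 1,
      theta = theta_hat -> TI_count theta 3,
      theta_c R < theta < theta_hat -> TI_count theta 5,
      theta = theta_c R -> TI_count theta 6
    & 0 < theta < theta_c R -> TI_count theta 7].
Proof.
have [v0 [hv0 crit hc cnum]] := theta_c_critical R.
have [T0 /andP[Tl Th] offP] := off_counts R.
have Tp : 0 < T0 by lra.
pose h := Num.sqrt T0.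
have h0 : 0 < h by rewrite sqrtr_gt0.
have h2 : h ^+ 2 = T0 by rewrite sqr_sqrtr // ltW.
clearbody h.
have hnum : `|h - 4812 / 10 ^+ 4| < 5 / 10 ^+ 5 .
  (* Fractions whose squares lie just outside the bracket of [T0], yet within the required tolerance
     of 0.4812. *)
  have lo : 115 / 239 < h by apply: (@lt_of_exprn _ 1); rewrite ?h2; lra.
  have hi : h < 1065 / 2213 by apply: (@lt_of_exprn _ 1); rewrite ?h2; lra.
  by rewrite ltr_norml; apply/andP; split; lra.
have ch : theta_c R < h.
  have lo : 2 / 5 < h by apply: (@lt_of_exprn _ 1); rewrite ?h2; lra.
  by move: cnum; rewrite ltr_norml => /andP[_]; lra.
exists h; split => // theta t0.
have [d1 d2 d3] := diag_counts hv0 t0 crit hc.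
have t2 : 0 < theta ^+ 2 by rewrite exprn_gt0.
have [n0 n1 n2] := offP _ t2.
have lt_sq (x y : R) : 0 < x -> 0 < y -> x < y -> x ^+ 2 < y ^+ 2.
  by move=> x0 y0 xy; rewrite ltr_pXn2r ?nnegrE ?(ltW x0) ?(ltW y0).
split.
- move=> ht; apply: (TI_countE (m := 0) t0 (d1 (lt_trans ch ht))).
  by apply: n0; rewrite -h2 lt_sq.
- move=> E; apply: (TI_countE (m := 1) t0 (d1 _)); first by rewrite E.
  by apply: n1; rewrite -h2 E.
- case/andP=> ct th; apply: (TI_countE (m := 2) t0 (d1 ct)).
  by apply: n2; rewrite -h2 lt_sq.
- move=> E; apply: (TI_countE (m := 2) t0 (d2 E)).
  by apply: n2; rewrite -h2 lt_sq // E.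
- case/andP=> _ tc; apply: (TI_countE (m := 2) t0 (d3 tc)).
  by apply: n2; rewrite -h2 lt_sq // (lt_trans tc).
Qed.

End System.

(** * From solutions of the system to measures *)

Section Counting.
Local Open Scope classical_set_scope.
Variables (R : realType) (theta : R).
Hypothesis theta_gt0 : 0 < theta.

Definition law (z : R * R) (i : spin) : R :=
  if i == 0 :> nat then z.1 else if i == 1 :> nat then z.2 else 1.

Lemma law_gt0 z : (forall i, 0 < law z i) <-> 0 < z.1 /\ 0 < z.2.
Proof.
split=> [h|[h0 h1] i]; last by rewrite /law; case: ifP => // _; case: ifP.
by split; [exact: (h ord0)|exact: (h (Ordinal (isT : (1 < 3)%N)))].
Qed.

Lemma transfer_law z :
  [/\ transfer theta (law z) ord0 = z.1 + theta * z.2,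
      transfer theta (law z) (Ordinal (isT : (1 < 3)%N)) =
          theta * z.1 + z.2 + theta
    & transfer theta (law z) ord_max = theta * z.2 + 1].
Proof.
by split; rewrite /transfer !big_ord_recl big_ord0 /activity /allowed /law /=
  ?mul1r ?mulr1 ?mul0r ?add0r ?addr0 ?addrA.
Qed.

Lemma compatible_law z : 0 < z.1 -> 0 < z.2 ->
  compatible theta (fun _ : vertex 3 => law z) <-> TI_solution theta z.
Proof.
move=> z1 z2; have zp : forall i, 0 < law z i by apply/law_gt0.
rewrite compatible_constant //.
have [t0 t1 t2] := transfer_law z.
have d0 : 0 < theta * z.2 + 1 by rewrite addr_gt0 ?mulr_gt0.
split=> [[r rE]|[_ _ E1 E2]].
  have := rE ord_max; rewrite t2 /law /= mulr1 => r2.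
  have := rE ord0; rewrite t0 /law /= -r2 => r0.
  have := rE (Ordinal (isT : (1 < 3)%N)); rewrite t1 /law /= -r2 => r1.
  by split => //; rewrite expr_div_n ?r0 ?r1 mulrC mulKf // expf_neq0 // gt_eqF.
exists ((theta * z.2 + 1) ^+ 3).
have e (a b : R) : a = (b / (theta * z.2 + 1)) ^+ 3 ->
   b ^+ 3 = (theta * z.2 + 1) ^+ 3 * a.
  by move=> ->; rewrite expr_div_n mulrC divfK // expf_neq0 // gt_eqF.
case=> [[|[|[]]] //= hi].
- by rewrite (_ : Ordinal hi = ord0) ?t0; [exact: e|exact: val_inj].
- by rewrite (_ : Ordinal hi = Ordinal (isT : (1 < 3)%N)) ?t1;
    [exact: e|exact: val_inj].
- by rewrite (_ : Ordinal hi = ord_max) ?t2 ?mulr1; [|exact: val_inj].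
Qed.

Definition SGM_of (z : R * R) (mu : probability (configs 3) R) : Prop :=
  forall n, (1 <= n)%N -> forall t, t \in finite_config (ball_V 3 n) ->
    mu (cylinder t) = (finite_gibbs theta (fun _ : vertex 3 => law z) t)%:E.

(** The boundary function is constant only off the root; replacing it by a constant everywhere
    leaves the finite Gibbs measures of positive radius unchanged. *)
Lemma TISGM_law mu : is_TISGM theta mu <-> exists2 z,
    TI_solution theta z & SGM_of z mu.
Proof.
split.
  case=> zz [[zp cmp muE] [z0 z0E]].
  have [y0 yE] : exists y : vertex 3, y != tree_root.
    have [|y Ey] := @child_exists 3 tree_root ord0; first by [].
    by exists y; apply/eqP => E; move: Ey; rewrite E.
  have [zp0 zm] := zp _ yE.
  pose z := (z0 ord0, z0 (Ordinal (isT : (1 < 3)%N))).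
  have zl : law z = z0.
    apply/funext => -[[|[|[|]]] //= hi]; rewrite /law /=.
    - by congr z0; apply: val_inj.
    - by congr z0; apply: val_inj.
    - by rewrite -zm z0E //; congr z0; apply: val_inj.
  have zz_law (x : vertex 3) : x != tree_root -> zz x = law z by move=> /z0E ->.
  have gE n (t : {ffun ball_V 3 n -> spin}) : (0 < n)%N ->
      finite_gibbs theta zz t = finite_gibbs theta (fun=> law z) t.
    move=> n0; rewrite /finite_gibbs (weight_ext theta _ n0 zz_law);
        congr (_ / _).
    by apply: eq_bigr => s _; exact: weight_ext.
  exists z.
    have zlp i : 0 < law z i by rewrite zl -(z0E _ yE).
    have /law_gt0[z1 z2] := zlp.
    apply/compatible_law => // n n2 t tn.
    have n1 : (0 < n.-1)%N by case: n n2 {t tn} => [|[]].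
    rewrite -gE // -cmp //; apply: eq_bigr => s _; rewrite gE //.
    by apply: leq_trans n2.
  by move=> n n0 t tn; rewrite muE // gE.
case=> z zs muE; have [z1 z2 _ _] := zs.
exists (fun=> law z); split; last by exists (law z).
split=> // [x _|]; first by split; [apply/law_gt0|].
exact/compatible_law.
Qed.

(** The constant configuration [i] on the ball of radius 1 has mass z_i to the power
    [sphere_size 3 1], over the partition function. The case i = 2, where z_2 = 1, equates the
    partition functions; taking roots does the rest. *)
Lemma SGM_of_inj z z' mu nu : TI_solution theta z -> TI_solution theta z' ->
  SGM_of z mu -> SGM_of z' nu -> same_measure mu nu -> z = z'.
Proof.
case=> z1 z2 _ _ [z1' z2' _ _] Hz Hz' E.
have zp : forall i, 0 < law z i by apply/law_gt0.
have zp' : forall i, 0 < law z' i by apply/law_gt0.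
have Z0 : 0 < partition_function theta (fun _ : vertex 3 => law z) 1%N.
  exact: partition_gt0.
have Z0' : 0 < partition_function theta (fun _ : vertex 3 => law z') 1%N.
  exact: partition_gt0.
have key i : law z i ^+ sphere_size 3 1 / partition_function theta (fun _ :
    vertex 3 => law z) 1%N =
    law z' i ^+ sphere_size 3 1 / partition_function theta (fun _ : vertex 3 =>
        law z') 1%N.
  have tn := const_config 3 1%N i.
  have := E _ (measurable_cylinder [ffun _ : ball_V 3 1%N => i]).
  rewrite (Hz 1%N isT _ tn) (Hz' 1%N isT _ tn) => -[].
  rewrite /finite_gibbs (weight_const theta (z0 := law z)) // (weight_const
      theta (z0 := law z')) //.
have ZZ : partition_function theta (fun _ : vertex 3 => law z) 1%N =
    partition_function theta (fun _ : vertex 3 => law z') 1%N.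
  by apply: invr_inj; have := key ord_max; rewrite /law /= expr1n !mul1r.
have lE i : law z i = law z' i.
  apply: (@pexpIrn _ (sphere_size 3 1)); rewrite ?sphere1_gt0 ?nnegrE ?ltW //.
  by apply: (mulIf (invr_neq0 (lt0r_neq0 Z0))); rewrite key ZZ.
rewrite (surjective_pairing z) (surjective_pairing z').
by rewrite (lE ord0 : z.1 = z'.1) (lE (Ordinal (isT : (1 < 3)%N)) : z.2 = z'.2).
Qed.

Lemma exactly_TISGM_count N : TI_count theta N -> exactly_TISGM 3 theta N.
Proof.
case=> s [us ss sP].
have sol (i : 'I_N) : TI_solution theta (nth (0, 0) s i).
  by apply/sP; rewrite mem_nth // ss.
have ex (i : 'I_N) : exists mu, SGM_of (nth (0, 0) s i) mu.
  have [z1 z2 _ _] := sol i.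
  apply: SGM_exists_of_compatible => //; last exact/compatible_law.
  by move=> x _; apply/law_gt0.
have [mu muP] := boolp.choice ex.
exists mu; split.
- by move=> i; apply/TISGM_law; exists (nth (0, 0) s i).
- move=> i j /(SGM_of_inj (sol i) (sol j) (muP i) (muP j)) /eqP.
  by rewrite nth_uniq ?ss // => /eqP /val_inj.
move=> nu /TISGM_law[z /sP zs nuP].
have iN : (index z s < N)%N by rewrite -ss index_mem.
exists (Ordinal iN); apply: same_measure_cylinders => n n0 t tn.
by rewrite nuP // muP //= nth_index.
Qed.

End Counting.

Theorem theorem2 (R : realType) :
  (* theta_c ~ 0.206 *)
  `|theta_c R - 206 / 10 ^+ 3| < 5 / 10 ^+ 4 /\
  exists theta_hat : R,
    (* theta_hat ~ 0.4812 *)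
    `|theta_hat - 4812 / 10 ^+ 4| < 5 / 10 ^+ 5 /\
    forall theta : R, 0 < theta ->
      [/\ theta_hat < theta -> exactly_TISGM 3 theta 1,
          theta = theta_hat -> exactly_TISGM 3 theta 3,
          theta_c R < theta < theta_hat -> exactly_TISGM 3 theta 5,
          theta = theta_c R -> exactly_TISGM 3 theta 6
        & 0 < theta < theta_c R -> exactly_TISGM 3 theta 7].
Proof.
have [v0 [_ _ _ num]] := theta_c_critical R; split=> //.
have [h [hnum hP]] := TI_counts R.
exists h; split=> // theta t0; have [h1 h3 h5 h6 h7] := hP theta t0.
by split=> H; apply: exactly_TISGM_count => //;
    [exact: h1|exact: h3|exact: h5|exact: h6|exact: h7].
Qed.
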